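(* Let $(\mathcal{J}_m)_{m\ge0}$ and $(S^{(m)})_{m\ge0}$ be any sequences of active sets and subdivisions produced by the MaxMod algorithm (defined in the context), with its standing assumptions. Assume $a_m\to0$ as $m\to\infty$, and that, for chosen subsets $\overset{\bullet}{\mathcal{C}}_{\mathcal{J}}\subseteq\mathcal{C}_{\mathcal{J}}$ (for $\mathcal{J}\subseteq\{1,\dots,D\}$ non-empty), the following hold: (1) $\mathcal{C}_D$ is convex and closed for the topology of uniform convergence. (2) For every $\mathcal{J}\supseteq\mathcal{J}_0$ and every $S\in\mathcal{S}_{\mathcal{J}}$ with $S_j\supseteq S^{(0)}_j$ for all $j\in\mathcal{J}_0$, the set $\{\alpha\in A_S:\ Y_{S,\alpha}\in\mathcal{I}_{X_{\mathcal{J}},y^{(n)}}\cap\overset{\bullet}{\mathcal{C}}_{\mathcal{J}}\}$ is non-empty. (3) $\{(Y_{S^{(0)},\alpha}(x^{(i)}_{\mathcal{J}_0}))_{i=1,\dots,n}:\ \alpha\in A_{S^{(0)}}\}=\mathbb{R}^n$. (4) For all $\mathcal{J}\subseteq\{1,\dots,D\}$, all $h\in\overset{\bullet}{\mathcal{C}}_{\mathcal{J}}$, all $r\in\mathbb{N}$ and all pairwise distinct $u_1,\dots,u_r\in[0,1]^{|\mathcal{J}|}$, with $U=(u_1,\dots,u_r)$ and $v^{(r)}=(h(u_1),\dots,h(u_r))$, the set $\mathrm{int}_{\|\cdot\|_{\mathcal{H}_{\mathcal{J}}}}(\mathcal{H}_{\mathcal{J}}\cap\mathcal{C}_{\mathcal{J}})\cap\mathcal{I}_{U,v^{(r)}}$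 is non-empty. (5) For all $\mathcal{J}\subseteq\{1,\dots,D\}$ and all $S\in\mathcal{S}_{\mathcal{J}}$, $\pi_S(\mathcal{C}_{\mathcal{J}})\subseteq\mathcal{C}_{\mathcal{J}}$. (6) For any $\mathcal{J}=(a_1,\dots,a_d)\subseteq\{1,\dots,D\}$ and any closed set $F=F_{a_1}\times\dots\times F_{a_d}\subseteq[0,1]^d$ with $0,1\in F_{a_j}$ for all $j$, for every $f\in\mathcal{C}_{\mathcal{J}}$ we have $P_{F\to[0,1]^d}(f_{|F})\in\mathcal{C}_{\mathcal{J}}$. Then: (i) for $m$ large enough, $\mathcal{J}_m=\{1,\dots,D\}$; (ii) for each $j\in\{1,\dots,D\}$, the set $S^{(m)}_j$ (well-defined for $m$ large enough) is dense in $[0,1]$ as $m\to\infty$, i.e. for every $x\in[0,1]$, $d(x,S^{(m)}_j)\to0$ as $m\to\infty$; (iii) consequently, as $m\to\infty$, the mode $\widehat{Y}_{\mathcal{J}_m,S^{(m)}}$ converges uniformly on $[0,1]^D$ to $$Y_{\mathrm{opt}}=\underset{f\in\mathcal{H}_D\cap\mathcal{C}_D\cap\mathcal{I}_{X_D,y^{(n)}}}{\mathrm{argmin}}\ \|f\|_{\mathcal{H}_D}.$$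
   Context: General notation: sets $\mathcal{J}=(a_1,\dots,a_d)\subseteq\{1,\dots,D\}$ of active variables are non-empty with $a_1<\dots<a_d$, $d=|\mathcal{J}|$; for $x\in\mathbb{R}^D$, $x_{\mathcal{J}}$ is the subvector of coordinates with indices in $\mathcal{J}$. For $x\in\mathbb{R}^q$, $B\subseteq\mathbb{R}^q$, $d(x,B)=\inf_{u\in B}\|x-u\|$. Constraint sets: $\mathcal{C}_D\subseteq\mathcal{C}([0,1]^D,\mathbb{R})$ (continuous functions) and $\mathcal{C}_{\mathcal{J}}$ is the set of $g:[0,1]^{|\mathcal{J}|}\to\mathbb{R}$ such that $x\in[0,1]^D\mapsto g(x_{\mathcal{J}})$ belongs to $\mathcal{C}_D$. Kernels: $k_D$ is the continuous covariance function on $[0,1]^D\times[0,1]^D$ of a centered Gaussian process with continuous trajectories; $k_{\mathcal{J}}(u,v)=k_D(\widetilde u,\widetilde v)$ for $u,v\in[0,1]^{|\mathcal{J}|}$, where $\widetilde u_{\mathcal{J}}=u$, $\widetilde v_{\mathcal{J}}=v$ and all other coordinates of $\widetilde u,\widetilde v$ are $0$. $\mathcal{H}_{\mathcal{J}}$ (resp. $\mathcal{H}_D$) is the RKHS of $k_{\mathcal{J}}$ (resp. $k_D$); $\mathrm{int}_{\|\cdot\|_{\mathcal{H}_{\mathcal{J}}}}$ is the interior in $\mathcal{H}_{\mathcal{J}}$ for the RKHS norm. Subdivisions: a one-dimensional subdivision is a finite set $S\subset\mathbb{R}$ with ordered elements $-1=t^{(S)}_{(0)}<0=t^{(S)}_{(1)}<\dots<t^{(S)}_{(m_S)}=1<t^{(S)}_{(m_S+1)}=2$;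 the smallest one is $S^0=\{-1,0,1,2\}$. $\mathcal{S}_{\mathcal{J}}$ is the set of vectors $S=(S_{a_1},\dots,S_{a_d})$ of one-dimensional subdivisions. Put $\mathcal{L}_S=\prod_{i=1}^d\{1,\dots,m_{S_{a_i}}\}$, $A_S=\mathbb{R}^{\mathcal{L}_S}$, $t^{(S)}_{\underline\ell}=(t^{(S_{a_1})}_{(\ell_{a_1})},\dots,t^{(S_{a_d})}_{(\ell_{a_d})})$ for $\underline\ell=(\ell_{a_1},\dots,\ell_{a_d})\in\mathcal{L}_S$. Basis functions: for $u<v<w$, $\phi_{u,v,w}(t)=\frac{t-u}{v-u}$ for $u\le t\le v$, $\frac{w-t}{w-v}$ for $v\le t\le w$, $0$ otherwise; $\phi^{(S)}_{\underline\ell}(t)=\prod_{i=1}^d\phi_{t^{(S_{a_i})}_{(\ell_{a_i}-1)},t^{(S_{a_i})}_{(\ell_{a_i})},t^{(S_{a_i})}_{(\ell_{a_i}+1)}}(t_{a_i})$ for $t=(t_{a_1},\dots,t_{a_d})\in[0,1]^d$. $Y_{S,\alpha}=\sum_{\underline\ell}\alpha_{\underline\ell}\phi^{(S)}_{\underline\ell}$ for $\alpha\in A_S$, and $\pi_S(f)=\sum_{\underline\ell}f(t^{(S)}_{\underline\ell})\phi^{(S)}_{\underline\ell}$ for $f:[0,1]^d\to\mathbb{R}$. Interpolation set: $\mathcal{I}_{U,v^{(r)}}=\{f:[0,1]^d\to\mathbb{R}: f(u_i)=v_i,\ i=1,\dots,r\}$ for $U=(u_1,\dots,u_r)\in([0,1]^d)^r$,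 $v^{(r)}\in\mathbb{R}^r$. Multiaffine extension: for $F=F_1\times\dots\times F_d$ with each $F_i\subseteq[0,1]$ closed containing $0,1$, and $f\in\mathcal{C}(F,\mathbb{R})$, $P_{F\to[0,1]^d}(f)$ is the unique continuous $g:[0,1]^d\to\mathbb{R}$ equal to $f$ on $F$ whose one-dimensional cuts in the $i$-th coordinate (other coordinates fixed arbitrarily in $[0,1]$) are affine on each interval contained in $[0,1]\setminus F_i$, for every $i$. Data: pairwise distinct $x_D^{(1)},\dots,x_D^{(n)}\in[0,1]^D$ and $y^{(n)}=(y_1,\dots,y_n)\in\mathbb{R}^n$; $x^{(i)}_{\mathcal{J}}=(x^{(i)}_D)_{\mathcal{J}}$, $X_{\mathcal{J}}=(x^{(1)}_{\mathcal{J}},\dots,x^{(n)}_{\mathcal{J}})$, $X_D=(x_D^{(1)},\dots,x_D^{(n)})$. Mode: $k_{\mathcal{J}}(S,S)=[k_{\mathcal{J}}(t^{(S)}_{\underline\ell},t^{(S)}_{\underline\ell'})]_{\underline\ell,\underline\ell'}$, assumed invertible for all $\mathcal{J}$ and $S\in\mathcal{S}_{\mathcal{J}}$; $\widehat\alpha_{\mathcal{J},S}=\mathrm{argmin}\{\alpha^\top k_{\mathcal{J}}(S,S)^{-1}\alpha:\alpha\in A_S,\ Y_{S,\alpha}\in\mathcal{I}_{X_{\mathcal{J}},y^{(n)}}\cap\mathcal{C}_{\mathcal{J}}\}$, $\widehat{Y}_{\mathcal{J},S}=Y_{S,\widehat\alpha_{\mathcal{J},S}}$. Updates: for $i\in\mathcal{J}$,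 $t\in[0,1]\setminus S_i$, $S\cup_i t$ is $S$ with $S_i$ replaced by $S_i\cup\{t\}$. For $i\notin\mathcal{J}$, $S+i\in\mathcal{S}_{\mathcal{J}\cup\{i\}}$ is $S$ complemented by the one-dimensional subdivision $S^0$ for variable $i$. Criterion: $N_{S,\mathcal{J},i}=\prod_{j\in\mathcal{J},j\ne i}(|S_j|-2)$ (empty product $=1$). With $d=|\mathcal{J}|$, $I_{\mathcal{J},S}(i,t)=\frac{1}{N_{S,\mathcal{J},i}}\int_{[0,1]^d}(\widehat{Y}_{\mathcal{J},S\cup_i t}(x)-\widehat{Y}_{\mathcal{J},S}(x))^2dx$ if $i\in\mathcal{J}$, and $I_{\mathcal{J},S}(i,t)=\frac{1}{N_{S,\mathcal{J},i}}\int_{[0,1]^{d+1}}(\widehat{Y}_{\mathcal{J}\cup\{i\},S+i}(x)-\widehat{Y}_{\mathcal{J},S}(x))^2dx$ if $i\notin\mathcal{J}$ (in which case $\widehat{Y}_{\mathcal{J},S}$ is seen as a function of the variables in $\mathcal{J}\cup\{i\}$ not depending on variable $i$). Reward, for fixed $\Delta,\Delta'>0$: $R_{\mathcal{J},S}(i,t)=\Delta\, d(t,S_i)$ if $i\in\mathcal{J}$, and $\Delta'$ otherwise. MaxMod algorithm. Inputs: $\Delta,\Delta'>0$; sequences $(a_m)_{m\ge 0},(b_m)_{m\ge 0}$ of strictly positive numbers; a non-empty $\mathcal{J}_0\subseteq\{1,\dots,D\}$ and $S^{(0)}\in\mathcal{S}_{\mathcal{J}_0}$. Standing assumptions: $2b_m(\max_{i\in\mathcal{J}_0}|S^{(0)}_i|+m)<1$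 for all $m$; $x^{(1)}_{\mathcal{J}_0},\dots,x^{(n)}_{\mathcal{J}_0}$ are pairwise distinct; $\{\alpha\in A_{S^{(0)}}:Y_{S^{(0)},\alpha}\in\mathcal{I}_{X_{\mathcal{J}_0},y^{(n)}}\cap\mathcal{C}_{\mathcal{J}_0}\}\ne\emptyset$. For each $m\ge0$: choose $i^\star_{m+1}\in\{1,\dots,D\}$ and $t^\star_{m+1}\in[0,1]$, with $d(t^\star_{m+1},S^{(m)}_{i^\star_{m+1}})\ge b_m$ if $i^\star_{m+1}\in\mathcal{J}_m$, such that $$I_{\mathcal{J}_m,S^{(m)}}(i^\star_{m+1},t^\star_{m+1})+R_{\mathcal{J}_m,S^{(m)}}(i^\star_{m+1},t^\star_{m+1})+a_m\ \ge\ \sup\big(I_{\mathcal{J}_m,S^{(m)}}(i,t)+R_{\mathcal{J}_m,S^{(m)}}(i,t)\big),$$ the supremum being over $i\in\{1,\dots,D\}$, $t\in[0,1]$ with $d(t,S^{(m)}_i)\ge b_m$ if $i\in\mathcal{J}_m$. If $i^\star_{m+1}\in\mathcal{J}_m$, set $\mathcal{J}_{m+1}=\mathcal{J}_m$, $S^{(m+1)}=S^{(m)}\cup_{i^\star_{m+1}}t^\star_{m+1}$; otherwise set $\mathcal{J}_{m+1}=\mathcal{J}_m\cup\{i^\star_{m+1}\}$, $S^{(m+1)}=S^{(m)}+i^\star_{m+1}$. *)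

(* Defs.v *)
From HB Require Import structures.
From mathcomp Require Import all_boot all_order all_algebra.
From mathcomp Require Import finmap.
From mathcomp Require Import all_classical all_reals all_analysis.

Set Implicit Arguments.
Unset Strict Implicit.
Unset Printing Implicit Defensive.

Import Order.TTheory GRing.Theory Num.Theory.
Import numFieldNormedType.Exports.

Local Open Scope classical_set_scope.
Local Open Scope ring_scope.

Definition argmin (R : realType) (T : Type) (A : set T) (F : T -> R) : set T :=
  [set x | A x /\ forall z, A z -> F x <= F z].

Definition dist (R : realType) (t : R) (B : set R) : R :=
  inf [set `|t - u| | u in B].

(* Used through the coercion [set_type] as a type, whose topology is the one
   induced by ['rV[R]_d]. *)
Definition cube (R : realType) (d : nat) : set 'rV[R]_d :=
  [set x | forall k, 0 <= x 0 k <= 1].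
Arguments cube : clear implicits.

Lemma cube0 (R : realType) (d : nat) : (0 : 'rV[R]_d) \in cube R d.
Proof. by rewrite inE => k; rewrite mxE lexx ler01. Qed.

(* The point of the cube with underlying vector [x]; only applied to vectors
   lying in the cube (junk value 0 otherwise). *)
Definition to_cube (R : realType) (d : nat) (x : 'rV[R]_d) : cube R d :=
  insubd (exist _ 0 (cube0 R d) : cube R d) x.

Definition cube_coord (R : realType) (d : nat) (x : cube R d)
    (k : 'I_d) : R :=
  (\val x : 'rV[R]_d) 0 k.

(* For J = (a_1 < ... < a_d), a_k is [enum_val k] for [k : 'I_#|J|] (the
   enumeration of a set of ordinals is increasing). *)
Definition subvec (R : realType) (D : nat) (J : {set 'I_D}) (x : cube R D) :
    cube R #|J| :=
  to_cube (\row_k cube_coord x (enum_val k)).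

Definition zero_ext (R : realType) (D : nat) (J : {set 'I_D})
    (u : cube R #|J|) : cube R D :=
  to_cube (\row_i
    if [pick k : 'I_#|J| | enum_val k == i] is Some k
    then cube_coord u k else 0).

(* Lebesgue measure on [0,1]^d, as the d-fold product of the Lebesgue measure
   on [0,1] (which is the uniform probability). *)
Section cube_measure.
Context (R : realType).

Definition tuple_cons (d : nat)
    (p : measurableTypeR R * d.-tuple (measurableTypeR R)) :
    d.+1.-tuple (measurableTypeR R) := [tuple of p.1 :: p.2].

Lemma measurable_tuple_cons (d : nat) :
  measurable_fun setT (@tuple_cons d).
Proof. exact: measurable_cons. Qed.

HB.instance Definition _ (d : nat) :=
  isMeasurableFun.Build _ _ _ _ (@tuple_cons d) (@measurable_tuple_cons d).

Fixpoint cube_measure (d : nat) :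
    probability (d.-tuple (measurableTypeR R)) R :=
  match d with
  | 0%N => \d_([tuple] : 0.-tuple (measurableTypeR R))
  | d'.+1 => distribution (uniform_prob (@ltr01 R) \x cube_measure d')%E
               (@tuple_cons d')
  end.

Definition cube_integral (d : nat) (f : cube R d -> R) : R :=
  \int[cube_measure d]_x f (to_cube (\row_k tnth x k)).

End cube_measure.

Section gaussian.
Context (R : realType) (dOm : measure_display) (Om : measurableType dOm).
Context (P : probability Om R) (T : Type).

(* N(m, s^2), including the degenerate case s = 0. *)
Definition gaussian_law (m s : R) (A : set R) : \bar R :=
  if s == 0 then \d_m A else normal_prob m s A.

Definition gaussian_process (Z : T -> {RV P >-> R}) :=
  forall (r : nat) (x : 'I_r -> T) (c : 'I_r -> R), exists m s : R,
    forall A : set R, measurable A ->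
      P ((fun w => \sum_i c i * Z (x i) w) @^-1` A) = gaussian_law m s A.

Definition centered (Z : T -> {RV P >-> R}) :=
  forall x, ('E_P[Z x] = 0)%E.

Definition has_covariance (Z : T -> {RV P >-> R}) (k : T -> T -> R) :=
  forall x z, covariance P (Z x) (Z z) = (k x z)%:E.

End gaussian.

(* A real Hilbert space of functions on [T] whose reproducing kernel is [k];
   by the Moore-Aronszajn theorem it exists and is unique when [k] is symmetric
   positive semidefinite. *)
Record rkhs (R : realType) (T : Type) (k : T -> T -> R) := Rkhs {
  rkhs_space :> set (T -> R);
  rkhs_ip : (T -> R) -> (T -> R) -> R;
  rkhs_0 : rkhs_space (fun=> 0);
  rkhs_lin : forall (a : R) f g, rkhs_space f -> rkhs_space g ->
    rkhs_space (fun x => a * f x + g x);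
  rkhs_ip_sym : forall f g, rkhs_space f -> rkhs_space g ->
    rkhs_ip f g = rkhs_ip g f;
  rkhs_ip_lin : forall (a : R) f g h,
    rkhs_space f -> rkhs_space g -> rkhs_space h ->
    rkhs_ip (fun x => a * f x + g x) h = a * rkhs_ip f h + rkhs_ip g h;
  rkhs_ip_ge0 : forall f, rkhs_space f -> 0 <= rkhs_ip f f;
  rkhs_ip_def : forall f, rkhs_space f -> rkhs_ip f f = 0 -> f = (fun=> 0);
  rkhs_norm (f : T -> R) := Num.sqrt (rkhs_ip f f);
  rkhs_complete : forall f_ : nat -> T -> R, (forall p, rkhs_space (f_ p)) ->
    (forall e : R, 0 < e -> exists N : nat, forall p q : nat,
      (N <= p)%N -> (N <= q)%N -> rkhs_norm (fun x => f_ p x - f_ q x) < e) ->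
    exists2 f, rkhs_space f &
      (fun p => rkhs_norm (fun x => f_ p x - f x)) @ \oo --> (0 : R);
  rkhs_kernel : forall x, rkhs_space (fun z => k z x);
  rkhs_reproducing : forall f x, rkhs_space f ->
    f x = rkhs_ip f (fun z => k z x) }.

Definition rkhs_interior (R : realType) (T : Type) (k : T -> T -> R)
    (H : rkhs k) (A : set (T -> R)) : set (T -> R) :=
  [set f | rkhs_space H f /\ exists2 e : R, 0 < e &
    forall g, rkhs_space H g -> rkhs_norm H (fun x => g x - f x) < e -> A g].

Definition kernelJ (R : realType) (D : nat) (kD : cube R D -> cube R D -> R)
    (J : {set 'I_D}) (u v : cube R #|J|) : R :=
  kD (zero_ext u) (zero_ext v).
Arguments kernelJ {R D} kD J.

Definition constraintJ (R : realType) (D : nat) (CD : set (cube R D -> R))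
    (J : {set 'I_D}) : set (cube R #|J| -> R) :=
  [set g | CD (fun x => g (subvec J x))].
Arguments constraintJ {R D} CD J.

Definition convex_functions (R : realType) (T : Type) (C : set (T -> R)) :=
  forall f g (t : R), C f -> C g -> 0 <= t <= 1 ->
    C (fun x => t * f x + (1 - t) * g x).

Definition interpolating (R : realType) (T : Type) (r : nat) (U : 'I_r -> T)
    (v : 'I_r -> R) : set (T -> R) :=
  [set f | forall i, f (U i) = v i].

(* [multiaffine_ext F f g]: g extends the restriction of f to
   F_1 x ... x F_d as a continuous function, affinely in each coordinate
   outside of F; only the values of f on F_1 x ... x F_d matter. *)
Definition multiaffine_ext (R : realType) (d : nat) (F : 'I_d -> set R)
    (f g : cube R d -> R) :=
  [/\ continuous g,
      forall x : cube R d, (forall k, F k (cube_coord x k)) -> g x = f x &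
      forall (k : 'I_d) (x : cube R d) (A : set R),
        is_interval A -> A `<=` `[0, 1] `\` F k ->
        exists a b : R, forall z : cube R d,
          (forall j, j != k -> cube_coord z j = cube_coord x j) ->
          A (cube_coord z k) ->
          g z = a * cube_coord z k + b].

Definition multiaffine (R : realType) (d : nat) (F : 'I_d -> set R)
    (f : cube R d -> R) : cube R d -> R :=
  xget f [set g | multiaffine_ext F f g].

Section subdivision.
Context (R : realType).
Implicit Types S : {fset R}.

Definition node S (l : nat) : R := nth 0 (sort <=%R S) l.

(* m_S, the number of points of the subdivision in [0,1] *)
Definition msub S : nat := (#|` S| - 2)%N.

Definition is_subdivision S :=
  [/\ node S 0%N = -1, node S 1%N = 0, node S (msub S) = 1 &
      node S (msub S).+1 = 2].

Definition subdiv0 : {fset R} := [fset -1; 0; 1; 2]%fset.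

Definition hat (u v w t : R) : R :=
  if u <= t <= v then (t - u) / (v - u)
  else if v <= t <= w then (w - t) / (w - v)
  else 0.

End subdivision.

Section interpolation.
Context (R : realType) (d : nat).
Implicit Types S : 'I_d -> {fset R}.

(* Multi-indices are shifted by one: the component [l k] ranges over
   0, ..., m_{S_k} - 1 and stands for the index [(l k).+1]. *)
Definition multi_index S := {dffun forall k : 'I_d, 'I_(msub (S k))}.

Definition knot S (l : multi_index S) : cube R d :=
  to_cube (\row_k node (S k) (l k).+1).

Definition basis_fun S (l : multi_index S) (t : cube R d) : R :=
  \prod_k hat (node (S k) (l k)) (node (S k) (l k).+1) (node (S k) (l k).+2)
              (cube_coord t k).

(* Families indexed by L_S are column vectors, through [enum_rank] *)
Definition coefs S := 'cV[R]_#|{: multi_index S}|.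

Definition Yfun S (alpha : coefs S) (t : cube R d) : R :=
  \sum_(l : multi_index S) alpha (enum_rank l) 0 * basis_fun l t.

Definition interpolant S (f : cube R d -> R) (t : cube R d) : R :=
  \sum_(l : multi_index S) f (knot l) * basis_fun l t.

Definition gram (k : cube R d -> cube R d -> R) S :
    'M[R]_#|{: multi_index S}| :=
  \matrix_(p, q) k (knot (enum_val p)) (knot (enum_val q)).

Definition admissible S (C : set (cube R d -> R)) (n : nat)
    (X : 'I_n -> cube R d) (y : 'I_n -> R) : set (coefs S) :=
  [set alpha | (interpolating X y `&` C) (Yfun alpha)].

(* The default value 0 of [xget] is irrelevant whenever the minimizer
   exists. *)
Definition mode_coefs (k : cube R d -> cube R d -> R) S
    (C : set (cube R d -> R)) (n : nat) (X : 'I_n -> cube R d)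
    (y : 'I_n -> R) : coefs S :=
  xget 0 (argmin (admissible C X y)
    (fun alpha : coefs S => (alpha^T *m invmx (gram k S) *m alpha) 0 0)).

Definition mode (k : cube R d -> cube R d -> R) S (C : set (cube R d -> R))
    (n : nat) (X : 'I_n -> cube R d) (y : 'I_n -> R) : cube R d -> R :=
  Yfun (mode_coefs k S C X y).

End interpolation.

(* An element of S_J is given by a family over all of {1, ..., D}, of which
   only the components in J are meaningful. *)
Definition is_subdivisions (R : realType) (D : nat) (J : {set 'I_D})
    (S : 'I_D -> {fset R}) :=
  forall j, j \in J -> is_subdivision (S j).

Definition restr (R : realType) (D : nat) (J : {set 'I_D})
    (S : 'I_D -> {fset R}) : 'I_#|J| -> {fset R} :=
  fun k => S (enum_val k).
Arguments restr {R D} J S.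

Definition XJ (R : realType) (D n : nat) (X : 'I_n -> cube R D)
    (J : {set 'I_D}) (i : 'I_n) : cube R #|J| :=
  subvec J (X i).
Arguments XJ {R D n} X J i.

Section maxmod.
Context (R : realType) (D n : nat).
Context (kD : cube R D -> cube R D -> R) (CD : set (cube R D -> R)).
Context (X : 'I_n -> cube R D) (y : 'I_n -> R).
Implicit Types (J : {set 'I_D}) (S : 'I_D -> {fset R}).

Definition modeJ J S : cube R #|J| -> R :=
  mode (kernelJ kD J) (restr J S) (constraintJ CD J) (XJ X J) y.
Arguments modeJ J S : clear implicits.

Definition add_knot S (i : 'I_D) (t : R) : 'I_D -> {fset R} :=
  fun j => if j == i then (t |` S j)%fset else S j.

Definition add_variable S (i : 'I_D) : 'I_D -> {fset R} :=
  fun j => if j == i then subdiv0 R else S j.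

Definition crit_norm S J (i : 'I_D) : nat :=
  (\prod_(j in J | j != i) (#|` S j| - 2))%N.

(* For x in [0,1]^(J u {i}), [subvec J (zero_ext x)] is x_J. *)
Definition crit J S (i : 'I_D) (t : R) : R :=
  (crit_norm S J i)%:R^-1 *
  (if i \in J then
     cube_integral (fun x : cube R #|J| =>
       (modeJ J (add_knot S i t) x - modeJ J S x) ^+ 2)
   else
     cube_integral (fun x : cube R #|(i |: J)%SET| =>
       (modeJ (i |: J)%SET (add_variable S i) x
        - modeJ J S (subvec J (zero_ext x))) ^+ 2)).

Definition reward (Delta Delta' : R) J S (i : 'I_D) (t : R) : R :=
  if i \in J then Delta * dist t [set` S i] else Delta'.

Definition candidate (b : R) J S (i : 'I_D) (t : R) :=
  0 <= t <= 1 /\ (i \in J -> b <= dist t [set` S i]).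

(* The supremum is taken in the extended reals, so that no boundedness of the
   criterion is presupposed. *)
Definition maxmod_choice (Delta Delta' a b : R) J S (i : 'I_D) (t : R) :=
  candidate b J S i t /\
  (ereal_sup [set (crit J S p.1 p.2 + reward Delta Delta' J S p.1 p.2)%:E
             | p in [set p : 'I_D * R | candidate b J S p.1 p.2]]
   <= (crit J S i t + reward Delta Delta' J S i t + a)%:E)%E.

Definition maxmod_step J S (i : 'I_D) (t : R) (J' : {set 'I_D})
    (S' : 'I_D -> {fset R}) :=
  if i \in J then J' = J /\ S' = add_knot S i t
  else J' = (i |: J)%SET /\ S' = add_variable S i.

Definition maxmod_run (Delta Delta' : R) (a b : nat -> R)
    (Jm : nat -> {set 'I_D}) (Sm : nat -> 'I_D -> {fset R}) :=
  forall m, exists i t,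
    maxmod_choice Delta Delta' (a m) (b m) (Jm m) (Sm m) i t /\
    maxmod_step (Jm m) (Sm m) i t (Jm m.+1) (Sm m.+1).

End maxmod.

Arguments modeJ {R D n} kD CD X y J S _.

(* Main.v *)
Require Import Defs.
From HB Require Import structures.
From mathcomp Require Import all_boot all_order all_algebra.
From mathcomp Require Import finmap.
From mathcomp Require Import all_classical all_reals all_analysis.
From mathcomp Require Import measurable_realfun ring lra.

(** Each selected candidate is almost optimal for the sum of the criterion I and
   the reward R, so everything rests on showing that the selected values of
   I + R tend to 0: then all available rewards tend to 0, which forces every
   variable to be activated and the knots to become dense.

   The set of active variables can only grow, hence is eventually a constant J
   (card_stationary), and from then on the grids are nested. The reward of the
   knot chosen at step m is Delta times its distance to the previous knots,
   which tends to 0 because an increasing union of subsets of [0,1] is totally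
   bounded (nested_dense). The criterion is at most the squared uniform
   distance between consecutive modes, so it remains to see that the modes of
   nested grids form a uniform Cauchy sequence, whether or not the grids
   become dense (modes_cauchy).

   The mode of a grid S is pi_S h, where pi_S is multiaffine interpolation and
   h minimizes the norm of the RKHS of J among the functions such that pi_S h
   satisfies the constraints and interpolates the data (mode_rkhs). Along
   nested grids the sets of h with pi_S h in the constraints decrease, by
   stability of the constraints under pi_S. The evaluations of pi_S h at the
   data points converge in the dual of the RKHS: the limit is the multiaffine
   average of h over the corners of the limit cell of the data point
   (limit_boxes), and the error is controlled because RKHS balls are
   equicontinuous (kernel_modulus) and interpolation is accurate at points
   close to the grid, however large its cells (interpolant_error). A convexity
   argument (minimizers_cvg) then shows that the minimizers converge in norm:
   feasibility for the moving interpolation conditions is restored by mixing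
   with a function interior to the constraints, which leaves room for a small
   correction in a fixed finite-dimensional space. The interior function comes
   from the Slater-type hypothesis applied at the finitely many corners of the
   limit cells, where values determine the limit evaluations; the correction
   space comes from the splines on the initial grid, which take arbitrary
   values at the data points.

   Once all variables are active and the knots are dense, interpolation
   converges to the identity, and the limit of the minimizers is the element of
   least norm of the RKHS that satisfies the constraints and interpolates the
   data. It remains to identify the RKHS indexed by the cube of the active
   variables with the one over the full cube (rkhs_pullback). *)

Set Implicit Arguments.
Unset Strict Implicit.
Unset Printing Implicit Defensive.

Import Order.TTheory GRing.Theory Num.Theory.
Import numFieldNormedType.Exports.

Local Open Scope classical_set_scope.
Local Open Scope ring_scope.

(** * Limits with explicit ranks *)

(** Convergence with its rank exposed: the proofs below choose one rank that
   serves several limits at once. *)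
Definition tends_to (R : realType) (u : nat -> R) (l : R) :=
  forall e, 0 < e -> exists N, forall p, (N <= p)%N -> `|u p - l| <= e.

Lemma cvg_tends_to (R : realType) (u : nat -> R) (l : R) :
  u @ \oo --> l -> tends_to u l.
Proof.
move=> /cvgrPdist_le ul e e0; have [N _ hN] := ul e e0.
by exists N => p Np; rewrite distrC; apply: hN.
Qed.

Lemma tends_to_cvg (R : realType) (u : nat -> R) (l : R) :
  tends_to u l -> u @ \oo --> l.
Proof.
move=> ul; apply/cvgrPdist_le => e e0; have [N hN] := ul e e0.
by exists N => // p /= Np; rewrite distrC; apply: hN.
Qed.

Lemma tends_to0_le (R : realType) (u : nat -> R) (e : R) :
  tends_to u 0 -> 0 < e -> exists N, forall p, (N <= p)%N -> u p <= e.
Proof.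
move=> u0 /u0[N hN]; exists N => p /hN; rewrite subr0.
by apply: le_trans; exact: ler_norm.
Qed.

Lemma le_of_eq (R : realType) (x y : R) : x = y -> x <= y.
Proof. by move->. Qed.

(** * Hilbert space geometry of an RKHS *)

Section rkhs_theory.
Context (R : realType) (T : Type) (k : T -> T -> R) (H : rkhs k).
Implicit Types (f g h : T -> R).

Local Notation ip := (rkhs_ip H).
Local Notation nrm := (rkhs_norm H).
Local Notation mem := (rkhs_space H).

Lemma mem_add f g : mem f -> mem g -> mem (f \+ g).
Proof.
move=> hf hg; have := rkhs_lin 1 hf hg.
by congr (mem _); apply/funext => x; rewrite mul1r.
Qed.

Lemma mem_scale a f : mem f -> mem (a \*o f).
Proof.
move=> hf; have := rkhs_lin a hf (rkhs_0 H).
by congr (mem _); apply/funext => x; rewrite addr0.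
Qed.

Lemma sub_addN f g : f \- g = f \+ (-1 \*o g).
Proof. by apply/funext => x /=; rewrite mulN1r. Qed.

Lemma mem_sub f g : mem f -> mem g -> mem (f \- g).
Proof. by move=> hf hg; rewrite sub_addN; apply/mem_add/mem_scale. Qed.

Lemma ip_addl f g h : mem f -> mem g -> mem h -> ip (f \+ g) h = ip f h + ip g h.
Proof.
move=> hf hg hh; have := rkhs_ip_lin 1 hf hg hh; rewrite mul1r => <-.
by congr (ip _ h); apply/funext => x; rewrite mul1r.
Qed.

Lemma ip0l h : mem h -> ip (fun=> 0) h = 0.
Proof.
move=> hh; have := rkhs_ip_lin 1 (rkhs_0 H) (rkhs_0 H) hh.
have -> : (fun _ : T => 1 * 0 + 0) = (fun=> 0) :> (T -> R).
  by apply/funext => x; rewrite mulr0 addr0.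
lra.
Qed.

Lemma ip_scalel a f h : mem f -> mem h -> ip (a \*o f) h = a * ip f h.
Proof.
move=> hf hh; have := rkhs_ip_lin a hf (rkhs_0 H) hh; rewrite ip0l// addr0 => <-.
by congr (ip _ h); apply/funext => x; rewrite addr0.
Qed.

Lemma ip_addr f g h : mem f -> mem g -> mem h -> ip h (f \+ g) = ip h f + ip h g.
Proof.
by move=> *; rewrite rkhs_ip_sym ?ip_addl ?[ip _ h]rkhs_ip_sym//; exact: mem_add.
Qed.

Lemma ip_scaler a f h : mem f -> mem h -> ip h (a \*o f) = a * ip h f.
Proof.
by move=> *; rewrite rkhs_ip_sym ?ip_scalel ?[ip _ h]rkhs_ip_sym//; exact: mem_scale.
Qed.

Lemma mem_sum (I : Type) (r : seq I) (c : I -> R) (F : I -> T -> R) :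
  (forall i, mem (F i)) -> mem (fun x => \sum_(i <- r) c i * F i x).
Proof.
move=> hF; elim: r => [|i r ih].
  by have := rkhs_0 H; congr mem; apply/funext => x; rewrite big_nil.
have := mem_add (mem_scale (c i) (hF i)) ih.
by congr mem; apply/funext => x /=; rewrite big_cons.
Qed.

Lemma ip_suml (I : Type) (r : seq I) (c : I -> R) (F : I -> T -> R) h :
  (forall i, mem (F i)) -> mem h ->
  ip (fun x => \sum_(i <- r) c i * F i x) h = \sum_(i <- r) c i * ip (F i) h.
Proof.
move=> hF hh; elim: r => [|i r ih].
  rewrite big_nil -[RHS](ip0l hh); congr (ip _ h).
  by apply/funext => x; rewrite big_nil.
rewrite big_cons -ih -ip_scalel// -ip_addl//; last 2 first.
- exact: mem_scale.
- exact: mem_sum.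
by congr (ip _ h); apply/funext => x /=; rewrite big_cons.
Qed.

Lemma norm_ge0 f : 0 <= nrm f.
Proof. exact: sqrtr_ge0. Qed.

Lemma norm_sq f : mem f -> nrm f ^+ 2 = ip f f.
Proof. by move=> hf; rewrite sqr_sqrtr//; exact: rkhs_ip_ge0. Qed.

Lemma norm_sq_add f g : mem f -> mem g ->
  nrm (f \+ g) ^+ 2 = nrm f ^+ 2 + 2 * ip f g + nrm g ^+ 2.
Proof.
move=> hf hg; have hfg := mem_add hf hg.
rewrite !norm_sq// ip_addl// !ip_addr// [ip g f]rkhs_ip_sym//; ring.
Qed.

Lemma norm_scale a f : mem f -> nrm (a \*o f) = `|a| * nrm f.
Proof.
move=> hf; rewrite /nrm ip_scalel//; last exact: mem_scale.
by rewrite ip_scaler// mulrA -expr2 sqrtrM ?sqr_ge0// sqrtr_sqr.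
Qed.

Lemma norm0 : nrm (fun=> 0) = 0.
Proof. by rewrite /nrm ip0l ?sqrtr0//; exact: rkhs_0. Qed.

Lemma norm_eq0 f : mem f -> nrm f = 0 -> f = (fun=> 0).
Proof.
by move=> hf f0; apply: (rkhs_ip_def hf); rewrite -norm_sq// f0 expr0n.
Qed.

Lemma cauchy_schwarz f g : mem f -> mem g -> `|ip f g| <= nrm f * nrm g.
Proof.
move=> hf hg.
have q t : 0 <= nrm f ^+ 2 + 2 * t * ip f g + t ^+ 2 * nrm g ^+ 2.
  have := norm_sq_add hf (mem_scale t hg); rewrite ip_scaler// norm_scale//.
  rewrite exprMn -normrX (ger0_norm (sqr_ge0 t)) mulrA => <-; exact: sqr_ge0.
have [g0|g0] := eqVneq (nrm g) 0.
  rewrite (norm_eq0 hg g0) rkhs_ip_sym//; last exact: rkhs_0.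
  by rewrite ip0l// normr0 mulr_ge0// norm_ge0.
have gp : 0 < nrm g by rewrite lt0r g0 norm_ge0.
rewrite -(@ler_pXn2r _ 2) ?nnegrE ?mulr_ge0 ?norm_ge0// real_normK ?num_real//.
have := q (- ip f g / nrm g ^+ 2).
set s := ip f g; set b := nrm g in gp *; set a := nrm f.
have -> : a ^+ 2 + 2 * (- s / b ^+ 2) * s + (- s / b ^+ 2) ^+ 2 * b ^+ 2
   = (a ^+ 2 * b ^+ 2 - s ^+ 2) / b ^+ 2.
  by field; rewrite gt_eqF.
by rewrite pmulr_lge0 ?invr_gt0 ?exprn_gt0// subr_ge0 -exprMn.
Qed.

Lemma norm_triangle f g : mem f -> mem g -> nrm (f \+ g) <= nrm f + nrm g.
Proof.
move=> hf hg; rewrite -(@ler_pXn2r _ 2) ?nnegrE ?addr_ge0 ?norm_ge0//.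
rewrite norm_sq_add// sqrrD; have := cauchy_schwarz hf hg.
have := ler_norm (ip f g); rewrite -mulr_natl; lra.
Qed.

Lemma norm_sub f g : mem f -> mem g -> nrm (f \- g) <= nrm f + nrm g.
Proof.
move=> hf hg; rewrite sub_addN (le_trans (norm_triangle _ (mem_scale _ _)))//.
by rewrite norm_scale// normrN1 mul1r.
Qed.

Lemma norm_subC f g : mem f -> mem g -> nrm (f \- g) = nrm (g \- f).
Proof.
move=> hf hg; rewrite -[RHS]mul1r -(normrN1 R) -norm_scale; last exact: mem_sub.
by congr nrm; apply/funext => x /=; lra.
Qed.

Lemma norm_dist f g : mem f -> mem g -> `|nrm f - nrm g| <= nrm (f \- g).
Proof.
move=> hf hg; rewrite ler_norml.
have fg : f = (f \- g) \+ g by apply/funext => x /=; lra.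
have gf : g = (g \- f) \+ f by apply/funext => x /=; lra.
have := norm_triangle (mem_sub hf hg) hg; rewrite -fg.
have := norm_triangle (mem_sub hg hf) hf; rewrite -gf norm_subC//; lra.
Qed.

Lemma parallelogram f g : mem f -> mem g ->
  nrm (f \- g) ^+ 2 = 2 * nrm f ^+ 2 + 2 * nrm g ^+ 2 - nrm (f \+ g) ^+ 2.
Proof.
move=> hf hg; rewrite sub_addN !norm_sq_add//; last exact: mem_scale.
rewrite ip_scaler// norm_scale// normrN1; lra.
Qed.

Lemma norm_sum (I : Type) (r : seq I) (c : I -> R) (F : I -> T -> R) :
  (forall i, mem (F i)) ->
  nrm (fun x => \sum_(i <- r) c i * F i x) <= \sum_(i <- r) `|c i| * nrm (F i).
Proof.
move=> hF; elim: r => [|i r ih].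
  rewrite big_nil -[leRHS]norm0; apply: le_of_eq; congr nrm.
  by apply/funext => x; rewrite big_nil.
have -> : (fun x : T => \sum_(j <- i :: r) c j * F j x) =
    (c i \*o F i) \+ (fun x : T => \sum_(i0 <- r) c i0 * F i0 x).
  by apply/funext => x /=; rewrite big_cons.
rewrite (le_trans (norm_triangle (mem_scale (c i) (hF i)) (mem_sum r c hF)))//.
by rewrite big_cons -norm_scale// lerD2l.
Qed.

Lemma kernel_mem x : mem (k^~ x). Proof. exact: rkhs_kernel. Qed.

Lemma kernel_ip x z : ip (k^~ x) (k^~ z) = k z x.
Proof. by rewrite -(rkhs_reproducing z (kernel_mem x)). Qed.

Lemma kernel_sym x z : k x z = k z x.
Proof. by rewrite -!kernel_ip rkhs_ip_sym//; exact: kernel_mem. Qed.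

Lemma norm_kernel x : nrm (k^~ x) = Num.sqrt (k x x).
Proof. by rewrite /nrm kernel_ip. Qed.

(** The reproducing property bounds evaluations by the norm, so that norm
   convergence is uniform wherever the diagonal of k is bounded. *)
Lemma eval_le f x : mem f -> `|f x| <= nrm f * Num.sqrt (k x x).
Proof.
move=> hf; rewrite (rkhs_reproducing x hf) -norm_kernel.
by apply: cauchy_schwarz => //; exact: kernel_mem.
Qed.

Lemma norm_kernel_sub x z :
  nrm ((k^~ x) \- (k^~ z)) = Num.sqrt (k x x + k z z - 2 * k x z).
Proof.
have hx := kernel_mem x; have hz := kernel_mem z.
have hs := mem_scale (-1) hz; have ha := mem_add hx hs.
rewrite /nrm sub_addN ip_addl ?ip_addr ?ip_scalel ?ip_scaler//.
by rewrite !kernel_ip (kernel_sym x z); congr Num.sqrt; lra.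
Qed.

Lemma eval_sub_le f x z : mem f ->
  `|f x - f z| <= nrm f * Num.sqrt (k x x + k z z - 2 * k x z).
Proof.
move=> hf; have hx := kernel_mem x; have hz := kernel_mem z.
rewrite (rkhs_reproducing x hf) (rkhs_reproducing z hf) -norm_kernel_sub.
have -> : ip f (k^~ x) - ip f (k^~ z) = ip f ((k^~ x) \- (k^~ z)).
  by rewrite sub_addN ip_addr ?ip_scaler//; [lra|exact: mem_scale].
by apply: cauchy_schwarz => //; exact: mem_sub.
Qed.

Lemma cauchy_limit (u : nat -> T -> R) : (forall p, mem (u p)) ->
  (forall e : R, 0 < e -> exists N, forall p q, (N <= p)%N -> (p <= q)%N ->
     nrm (u p \- u q) <= e) ->
  exists2 f, mem f & tends_to (fun p => nrm (u p \- f)) 0.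
Proof.
move=> hu cu; have [|f hf cf] := @rkhs_complete _ _ _ H u hu.
  move=> e e0; have [N hN] := cu (e / 2) (divr_gt0 e0 (ltr0Sn _ 1)).
  exists N => p q Np Nq; apply: (@le_lt_trans _ _ (e / 2)); last lra.
  have [pq|/ltnW qp] := leqP p q; first exact: hN.
  by rewrite (@norm_subC (u p) (u q))//; exact: hN.
by exists f => //; exact: cvg_tends_to.
Qed.

(** The parallelogram identity turns midpoints that are not shorter than d into
   small differences: this is how every minimizer below is obtained, in place
   of weak compactness. *)
Lemma minimizing_cauchy (u : nat -> T -> R) (d : R) : (forall p, mem (u p)) ->
  tends_to (fun p => nrm (u p)) d ->
  (forall e : R, 0 < e -> exists N, forall p q, (N <= p)%N -> (p <= q)%N ->
     2 * d - e <= nrm (u p \+ u q)) ->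
  exists2 f, mem f & tends_to (fun p => nrm (u p \- f)) 0.
Proof.
move=> hu ud ulow; apply: cauchy_limit => // e e0.
have d0 : 0 <= d.
  rewrite leNgt; apply/negP => d0; have [|N hN] := ud (- d / 2); first lra.
  have := hN N (leqnn N); have := norm_ge0 (u N).
  rewrite ler_norml; lra.
pose c := Num.min 1 (e ^+ 2 / (12 * d + 8)).
have cp : 0 < c by rewrite lt_min ltr01/= divr_gt0 ?exprn_gt0//; lra.
have c1 : c <= 1 by rewrite ge_min lexx.
have c2 : c * (12 * d + 8) <= e ^+ 2.
  by rewrite -ler_pdivlMr; [rewrite ge_min lexx orbT|lra].
have [N1 h1] := ud c cp; have [N2 h2] := ulow c cp.
exists (maxn N1 N2) => p q; rewrite geq_max => /andP[Np1 Np2] pq.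
rewrite -(@ler_pXn2r _ 2) ?nnegrE ?norm_ge0 ?(ltW e0)// parallelogram//.
have := h2 p q Np2 pq; have := h1 p Np1; have := h1 q (leq_trans Np1 pq).
have := norm_ge0 (u p); have := norm_ge0 (u q); have := norm_ge0 (u p \+ u q).
move: (nrm (u p)) (nrm (u q)) (nrm (u p \+ u q)) => a b s s0 b0 a0.
rewrite !ler_distl => /andP[_ hb] /andP[_ ha] hs.
have ha2 : a ^+ 2 <= (d + c) ^+ 2 by rewrite ler_pXn2r// ?nnegrE; lra.
have hb2 : b ^+ 2 <= (d + c) ^+ 2 by rewrite ler_pXn2r// ?nnegrE; lra.
have [dc|dc] := lerP 0 (2 * d - c).
  have hs2 : (2 * d - c) ^+ 2 <= s ^+ 2 by rewrite ler_pXn2r// ?nnegrE; lra.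
  nra.
have : 0 <= s ^+ 2 by exact: sqr_ge0.
nra.
Qed.

End rkhs_theory.

(** * Uniqueness of the RKHS of a kernel *)

Section rkhs_pullback.
Context (R : realType) (T1 T2 : Type) (k1 : T1 -> T1 -> R) (k2 : T2 -> T2 -> R).
Context (H1 : rkhs k1) (H2 : rkhs k2) (phi : T2 -> T1) (psi : T1 -> T2).
Hypothesis psiK : forall x, phi (psi x) = x.
Hypothesis k12 : forall x z, k2 x z = k1 (phi x) (phi z).

Local Notation mem1 := (rkhs_space H1).
Local Notation mem2 := (rkhs_space H2).

Definition kspan (s : seq (R * T1)) : T1 -> R :=
  fun x => \sum_(i <- s) i.1 * k1 x i.2.

Lemma kspan_mem s : mem1 (kspan s).
Proof. by apply: (mem_sum s (fun i => i.1) (F := fun i : R * T1 => k1^~ i.2)) => i; exact: kernel_mem. Qed.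

Lemma kspan_comp s :
  kspan s \o phi = (fun x => \sum_(i <- s) i.1 * k2 x (psi i.2)).
Proof. by apply/funext => x /=; apply: eq_bigr => i _; rewrite k12 psiK. Qed.

Lemma kspan_comp_mem s : mem2 (kspan s \o phi).
Proof.
rewrite kspan_comp.
by apply: (mem_sum s (fun i => i.1) (F := fun i : R * T1 => k2^~ (psi i.2))) => i; exact: kernel_mem.
Qed.

Lemma kspan_norm s : rkhs_norm H2 (kspan s \o phi) = rkhs_norm H1 (kspan s).
Proof.
congr Num.sqrt; have h1 := kspan_mem s; have h2 := kspan_comp_mem s.
rewrite {1}kspan_comp (ip_suml s (fun i => i.1) (F := fun i : R * T1 => k2^~ (psi i.2)))//; last first.
  by move=> i; exact: kernel_mem.
rewrite {2}/kspan (ip_suml s (fun i => i.1) (F := fun i : R * T1 => k1^~ i.2))//; last first.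
  by move=> i; exact: kernel_mem.
apply: eq_bigr => i _; congr (_ * _).
rewrite rkhs_ip_sym//; last exact: kernel_mem.
rewrite [in RHS]rkhs_ip_sym//; last exact: kernel_mem.
by rewrite -(rkhs_reproducing _ h1) -(rkhs_reproducing _ h2)/= psiK.
Qed.

Lemma kspan_sub s t : exists w, kspan w = kspan s \- kspan t.
Proof.
exists (s ++ [seq (- i.1, i.2) | i <- t]); apply/funext => x /=.
rewrite /kspan big_cat big_map /=; congr (_ + _).
by rewrite -sumrN; apply: eq_bigr => i _; rewrite mulNr.
Qed.

Lemma kspan_addscale s t a : exists w, kspan w = kspan s \+ (a \*o kspan t).
Proof.
exists (s ++ [seq (a * i.1, i.2) | i <- t]); apply/funext => x /=.
rewrite /kspan big_cat big_map /=; congr (_ + _).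
by rewrite mulr_sumr; apply: eq_bigr => i _; rewrite mulrA.
Qed.

(** A minimizing sequence of combinations leaves a residual orthogonal to all
   kernel sections, and such a residual vanishes at every point. *)
Lemma kspan_dense f : mem1 f ->
  exists s : nat -> seq (R * T1),
    tends_to (fun p => rkhs_norm H1 (f \- kspan (s p))) 0.
Proof.
move=> hf; pose D := [set rkhs_norm H1 (f \- kspan s) | s in [set: seq (R * T1)]].
have D0 : D !=set0 by exists (rkhs_norm H1 (f \- kspan [::])); exists [::].
have Dlb : has_lbound D by exists 0 => _ [s _ <-]; exact: norm_ge0.
have hi : has_inf D by [].
pose d := inf D.
have dle s : d <= rkhs_norm H1 (f \- kspan s) by apply: ge_inf => //; exists s.
have /choice[s hs] : forall p, exists s,
    rkhs_norm H1 (f \- kspan s) < d + p.+1%:R^-1.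
  move=> p; have [|_ [s _ <-] ?] := @inf_adherent _ D p.+1%:R^-1 _ hi.
    by rewrite invr_gt0.
  by exists s.
exists s; pose u p := f \- kspan (s p).
have hu p : mem1 (u p) by apply: mem_sub => //; exact: kspan_mem.
have ud : tends_to (fun p => rkhs_norm H1 (u p)) d.
  move=> e e0; have [N hN] := cvg_tends_to (@cvg_harmonic R) e0.
  exists N => p /hN /=; rewrite subr0 ger0_norm ?invr_ge0// => pe.
  rewrite ger0_norm ?subr_ge0 ?dle//.
  by apply: le_trans pe; rewrite lerBlDl; exact: ltW (hs p).
have mid p q : 2 * d <= rkhs_norm H1 (u p \+ u q).
  have [w hw] := kspan_addscale (s p) (s q) 1.
  have [w' hw'] := kspan_addscale [::] w (1/2).
  have := dle w'; rewrite -(@ler_pM2l _ 2)// => /le_trans; apply.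
  rewrite -[X in X * _](@ger0_norm _ (2 : R))// -norm_scale; last first.
    by apply: mem_sub => //; exact: kspan_mem.
  apply: le_of_eq; congr rkhs_norm; apply/funext => x.
  by rewrite /= hw' hw /= /u /= {1}/kspan big_nil; lra.
have [v hv uv] : exists2 v, mem1 v & tends_to (fun p => rkhs_norm H1 (u p \- v)) 0.
  apply: (minimizing_cauchy hu ud) => e e0; exists 0%N => p q _ _.
  by have := mid p q; lra.
have v0 x : v x = 0.
  have hx := kernel_mem H1 x.
  have low t : d <= rkhs_norm H1 (v \+ (t \*o (k1^~ x))).
    apply/ler_addgt0Pr => e e0; have [N hN] := uv e e0.
    have := hN N (leqnn N); rewrite subr0 ger0_norm ?norm_ge0// => huv.
    have [w hw] := kspan_addscale (s N) [:: (1, x)] (- t).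
    have := dle w; have -> : f \- kspan w = (u N \- v) \+ (v \+ (t \*o (k1^~ x))).
      by apply/funext => z /=; rewrite hw /= /u /= {2}/kspan big_seq1/=; lra.
    have := norm_triangle (mem_sub (hu N) hv) (mem_add hv (mem_scale t hx)).
    lra.
  have vd : rkhs_norm H1 v <= d.
    apply/ler_addgt0Pr => e e0; have e20 : 0 < e / 2 by lra.
    have [N hN] := uv (e / 2) e20; have [M hM] := ud (e / 2) e20.
    have := hN _ (leq_maxl N M); have := hM _ (leq_maxr N M); move: (maxn N M) => p.
    rewrite subr0 [X in _ -> X <= _ -> _]ger0_norm ?norm_ge0// ler_distl => /andP[_ h1] h2.
    have := norm_dist hv (hu p); rewrite norm_subC// ler_distl => /andP[_]; lra.
  have d0 : 0 <= d := le_trans (norm_ge0 _ _) vd.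
  have q t : 0 <= 2 * t * v x + t ^+ 2 * k1 x x.
    have := low t; rewrite -(@ler_pXn2r _ 2) ?nnegrE ?norm_ge0//.
    rewrite norm_sq_add//; last exact: mem_scale.
    rewrite ip_scaler// norm_scale// exprMn -normrX (ger0_norm (sqr_ge0 t)).
    rewrite [rkhs_norm _ _ ^+ 2 in X in _ + X]norm_sq// kernel_ip -rkhs_reproducing//.
    have : rkhs_norm H1 v ^+ 2 <= d ^+ 2 by rewrite ler_pXn2r ?nnegrE ?norm_ge0.
    lra.
  have kx : 0 <= k1 x x by rewrite -(kernel_ip H1) rkhs_ip_ge0.
  have := q (- v x / (k1 x x + 1)).
  set c := k1 x x in kx *; set a := v x.
  have -> : 2 * (- a / (c + 1)) * a + (- a / (c + 1)) ^+ 2 * c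
          = - a ^+ 2 * ((c + 2) / (c + 1) ^+ 2).
    by field; rewrite gt_eqF//; lra.
  rewrite pmulr_lge0; last by rewrite divr_gt0 ?exprn_gt0//; lra.
  by rewrite oppr_ge0 => h; apply/eqP; rewrite -sqrf_eq0 eq_le h sqr_ge0.
have vE : v = fun=> 0 by apply/funext.
move=> e e0; have [N hN] := uv e e0; exists N => p Np.
by have := hN p Np; rewrite vE; congr (`|rkhs_norm H1 _ - _| <= _);
  apply/funext => x /=; rewrite subr0.
Qed.

(** The two norms agree on combinations of kernel sections, which are dense:
   the Moore-Aronszajn uniqueness argument, carried through a change of index. *)
Lemma rkhs_pullback f : mem1 f ->
  mem2 (f \o phi) /\ rkhs_norm H2 (f \o phi) = rkhs_norm H1 f.
Proof.
move=> hf; have [s hs] := kspan_dense hf.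
have hs1 p := kspan_mem (s p); have hs2 p := kspan_comp_mem (s p).
pose u p := kspan (s p) \o phi.
have sub2 p q : rkhs_norm H2 (u p \- u q) = rkhs_norm H1 (kspan (s p) \- kspan (s q)).
  by have [w hw] := kspan_sub (s p) (s q); rewrite -hw -kspan_norm hw.
have cu : forall e, 0 < e -> exists N, forall p q, (N <= p)%N -> (p <= q)%N ->
    rkhs_norm H2 (u p \- u q) <= e.
  move=> e e0; have [|N hN] := hs (e / 2); first lra.
  exists N => p q Np pq; have := hN p Np; have := hN q (leq_trans Np pq).
  rewrite !subr0 !ger0_norm ?norm_ge0// sub2 => hq hp.
  have -> : kspan (s p) \- kspan (s q) =
    (f \- kspan (s q)) \- (f \- kspan (s p)) by apply/funext => x /=; lra.
  have := norm_sub (mem_sub hf (hs1 q)) (mem_sub hf (hs1 p)); lra.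
have [f2 hf2 uf2] := cauchy_limit hs2 cu.
have f2E : f2 = f \o phi.
  apply/funext => x; apply/eqP; rewrite -subr_eq0 -normr_le0.
  apply/ler_addgt0Pr => e e0; rewrite add0r.
  set K := Num.sqrt (k1 (phi x) (phi x)).
  have K0 : 0 <= K by exact: sqrtr_ge0.
  have d0 : 0 < e / (2 * (K + 1)) by rewrite divr_gt0//; lra.
  have [N hN] := tends_to0_le hs d0; have [M hM] := tends_to0_le uf2 d0.
  have := hN _ (leq_maxl N M); have := hM _ (leq_maxr N M); move: (maxn N M) => p.
  move=> a2 a1.
  have := eval_le (phi x) (mem_sub hf (hs1 p)); rewrite -/K /= => b1.
  have := eval_le x (mem_sub (hs2 p) hf2); rewrite k12 -/K /= => b2.
  have -> : f2 x - f (phi x) =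
     - ((f (phi x) - kspan (s p) (phi x)) + (kspan (s p) (phi x) - f2 x)) by lra.
  rewrite normrN (le_trans (ler_normD _ _))//.
  have : e / (2 * (K + 1)) * (2 * (K + 1)) = e by rewrite divfK// gt_eqF//; lra.
  move: (e / _) a1 a2 d0 => t a1 a2 d0 te; rewrite /u /= in a2 b2.
  nra.
rewrite -f2E; split=> //; apply/eqP; rewrite -subr_eq0 -normr_le0.
apply/ler_addgt0Pr => e e0; rewrite add0r.
have d0 : 0 < e / 2 by lra.
have [N hN] := tends_to0_le hs d0; have [M hM] := tends_to0_le uf2 d0.
have := hN _ (leq_maxl N M); have := hM _ (leq_maxr N M); move: (maxn N M) => p.
move=> a2 a1.
have := norm_dist (hs2 p) hf2; have := norm_dist hf (hs1 p).
rewrite kspan_norm => b1 b2; rewrite distrC.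
rewrite (le_trans (ler_distD (rkhs_norm H1 (kspan (s p))) _ _))//.
by rewrite (splitr e) lerD// ?(le_trans b1)// (le_trans b2).
Qed.

End rkhs_pullback.

(** * Subdivisions and hat functions *)

Section cube_coordinates.
Context (R : realType) (d : nat).
Implicit Types (x z : cube R d).

Lemma coord_to_cube (x : 'rV[R]_d) k :
  (forall k, 0 <= x 0 k <= 1) -> cube_coord (to_cube x) k = x 0 k.
Proof.
by move=> hx; rewrite /cube_coord /to_cube val_insubd mem_set.
Qed.

Lemma coord_row (u : 'I_d -> R) k :
  (forall k, 0 <= u k <= 1) -> cube_coord (to_cube (\row_k u k)) k = u k.
Proof. by move=> hu; rewrite coord_to_cube ?mxE// => j; rewrite mxE. Qed.

Lemma coord01 x k : 0 <= cube_coord x k <= 1.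
Proof. by case: x => x /= hx; have := hx; rewrite inE; apply. Qed.

Lemma cube_ext x z : (forall k, cube_coord x k = cube_coord z k) -> x = z.
Proof. by move=> h; apply/val_inj/rowP. Qed.

End cube_coordinates.

Section subdivisions.
Context (R : realType).
Implicit Types (S : {fset R}) (t u v w x : R).

Lemma size_nodes S : size (sort <=%R S) = #|` S|.
Proof. by rewrite size_sort. Qed.

Lemma node_mem S i : (i < #|` S|)%N -> node S i \in S.
Proof. by move=> iS; rewrite -(mem_sort <=%R) mem_nth// size_nodes. Qed.

Lemma nodes_sorted S : sorted <%R (sort <=%R S).
Proof. by rewrite sort_lt_sorted fset_uniq. Qed.

Lemma node_lt S i j : (i < j)%N -> (j < #|` S|)%N -> node S i < node S j.
Proof.
move=> ij jS; rewrite /node.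
apply: (sorted_ltn_nth lt_trans 0 (nodes_sorted S)) => //.
  by rewrite inE size_nodes (ltn_trans ij).
by rewrite inE size_nodes.
Qed.

Lemma node_le S i j : (i <= j)%N -> (j < #|` S|)%N -> node S i <= node S j.
Proof.
by rewrite leq_eqVlt => /orP[/eqP->//|ij] jS; exact/ltW/node_lt.
Qed.

Lemma nodeP S t : t \in S -> exists2 i, (i < #|` S|)%N & node S i = t.
Proof.
move=> tS; exists (index t (sort <=%R S)).
  by rewrite -size_nodes index_mem mem_sort.
by rewrite /node nth_index// mem_sort.
Qed.

Lemma subdivision_size S : is_subdivision S -> #|` S| = (msub S).+2 /\ (1 < msub S)%N.
Proof.
move=> [h0 h1 hm hm1].
have m1 : (1 < msub S)%N.
  case: (msub S) hm => [|[|//]] hm; move: hm; rewrite ?h0 ?h1; lra.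
by split => //; move: m1; rewrite /msub; case: #|` S| => [|[|n]]//; rewrite !subSS subn0.
Qed.

Lemma is_subdivisionP S : is_subdivision S <->
  [/\ -1 \in S, 0 \in S, 1 \in S, 2 \in S &
      forall t, t \in S -> [\/ t = -1, t = 2 | 0 <= t <= 1]].
Proof.
split=> [hS|].
  have [cS m1] := subdivision_size hS.
  case: hS => h0 h1 hm hm1; have m0 := ltnW m1.
  have mS i : (i <= (msub S).+1)%N -> node S i \in S.
    by move=> im; apply: node_mem; rewrite cS.
  split.
  - by rewrite -h0 mS.
  - by rewrite -h1 mS.
  - by rewrite -hm mS.
  - by rewrite -hm1 mS.
  move=> t /nodeP[i iS <-]; have [->|i0] := posnP i; first exact: Or31.
  move: iS; rewrite cS ltnS leq_eqVlt => /orP[/eqP->|]; first exact: Or32.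
  rewrite ltnS => im; apply: Or33; rewrite -{1}h1 -hm !node_le//.
    by rewrite cS ltnW.
  by rewrite cS ltnW.
move=> [hN h0 h1 h2 hS].
have [iN iNS eN] := nodeP hN; have [i0 i0S e0] := nodeP h0.
have [i1 i1S e1] := nodeP h1; have [i2 i2S e2] := nodeP h2.
have lb i : (i < #|` S|)%N -> -1 <= node S i <= 2.
  by move=> iS; have [->|->|] := hS _ (node_mem iS); lra.
have n0 : node S 0 = -1.
  have := node_le (leq0n iN) iNS; rewrite eN => h.
  have := lb 0%N (leq_ltn_trans (leq0n _) iNS); lra.
have i0p : (0 < i0)%N by rewrite lt0n; apply/eqP => h; move: e0; rewrite h n0; lra.
have n1 : node S 1 = 0.
  have := node_le i0p i0S; rewrite e0 => h.
  have s1 : (1 < #|` S|)%N by exact: leq_ltn_trans i0S.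
  have := node_lt (ltn0Sn 0) s1; rewrite n0; move: h.
  by have [->|->|] := hS _ (node_mem s1); lra.
have [c cS] : exists c, #|` S| = c.+1.
  by exists #|` S|.-1; rewrite prednK// (leq_ltn_trans _ i0S).
rewrite cS in i2S.
have cc : (c < #|` S|)%N by rewrite cS.
have nc : node S c = 2.
  by have := node_le (i2S : (i2 <= c)%N) cc; have := lb c cc; rewrite e2; lra.
have i1c : (i1 < c)%N.
  rewrite ltn_neqAle -ltnS -cS i1S andbT.
  by apply/eqP => h; move: e1; rewrite h nc; lra.
case: c i1c cc nc cS {i2S} => [//|c] i1c cc nc cS.
have cc' : (c < #|` S|)%N by rewrite cS ltnW.
have nc' : node S c = 1.
  have := node_le (i1c : (i1 <= c)%N) cc'; rewrite e1.
  have := node_lt (ltnSn c) cc; rewrite nc.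
  by have [->|->|] := hS _ (node_mem cc'); lra.
by split => //; rewrite /msub cS !subSS subn0.
Qed.

Lemma subdivision_add S t : is_subdivision S -> 0 <= t <= 1 ->
  is_subdivision (t |` S)%fset.
Proof.
move=> /is_subdivisionP[hN h0 h1 h2 hS] t01; apply/is_subdivisionP.
rewrite !inE hN h0 h1 h2 !orbT; split=> // x.
by rewrite !inE => /orP[/eqP->|/hS//]; exact: Or33.
Qed.

Lemma subdivision0 : is_subdivision (subdiv0 R).
Proof.
apply/is_subdivisionP; rewrite !inE !eqxx !orbT; split=> // t.
rewrite !inE => /orP[/orP[/orP[]|]|] /eqP->; first exact: Or31.
- by apply: Or33; rewrite lexx ler01.
- by apply: Or33; rewrite lexx ler01.
exact: Or32.
Qed.

Lemma node01 S l : is_subdivision S -> (l < msub S)%N -> 0 <= node S l.+1 <= 1.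
Proof.
move=> hS lm; have [cS m1] := subdivision_size hS; case: hS => _ h1 hm _.
by rewrite -{1}h1 -hm !node_le// cS ltnS// ltnW// ltnS ltnW.
Qed.

Lemma node_of_mem S t : is_subdivision S -> t \in S -> 0 <= t <= 1 ->
  exists2 l, (l < msub S)%N & node S l.+1 = t.
Proof.
move=> hS tS t01; have [cS m1] := subdivision_size hS.
have [[|i]] := nodeP tS; case: hS => h0 h1 hm hm1; first by rewrite h0; lra.
rewrite cS !ltnS leq_eqVlt => /orP[/eqP->|im it]; first by rewrite hm1; lra.
by exists i.
Qed.

(** The degenerate case u = v is allowed on purpose: it is the cell of a point
   that belongs to S. *)
Definition gap S u v := forall s, s \in S -> s <= u \/ v <= s.

(** The division by 0 of a degenerate cell gives 0: all the weight goes to u. *)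
Definition ratio u v x : R := (x - u) / (v - u).

Lemma ratio01 u v x : u <= x <= v -> 0 <= ratio u v x <= 1.
Proof.
move=> /andP[ux xv]; rewrite /ratio; have [->|uv] := eqVneq v u.
  by rewrite subrr invr0 mulr0 lexx ler01.
have vu : 0 < v - u by rewrite subr_gt0 lt_neqAle eq_sym uv (le_trans ux).
by rewrite ler_pdivrMr// ler_pdivlMr//; apply/andP; split; lra.
Qed.

Lemma ratio_mean u v x : u <= x <= v ->
  (1 - ratio u v x) * u + ratio u v x * v = x.
Proof.
move=> /andP[ux xv]; rewrite /ratio; have [vu|uv] := eqVneq v u.
  by rewrite vu subrr invr0; lra.
by field; rewrite subr_eq0.
Qed.

Lemma hat_left u v w t : u < v -> v < w -> t <= u -> hat u v w t = 0.
Proof.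
move=> uv vw tu; rewrite /hat; case: ifPn => [/andP[ut _]|_].
  by rewrite (_ : t = u) ?subrr ?mul0r//; lra.
by case: ifPn => // /andP[]; lra.
Qed.

Lemma hat_right u v w t : u < v -> v < w -> w <= t -> hat u v w t = 0.
Proof.
move=> uv vw wt; rewrite /hat; case: ifPn => [/andP[_]|_]; first lra.
by case: ifPn => // /andP[_ tw]; rewrite (_ : t = w) ?subrr ?mul0r//; lra.
Qed.

Lemma hat_up u v w t : u <= t <= v -> hat u v w t = (t - u) / (v - u).
Proof. by rewrite /hat => ->. Qed.

Lemma hat_down u v w t : u < v -> v < w -> v <= t <= w ->
  hat u v w t = (w - t) / (w - v).
Proof.
move=> uv vw /andP[vt tw]; rewrite /hat; case: ifPn => [/andP[_ tv]|_].
  have -> : t = v by lra.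
  by rewrite !divff// subr_eq0 gt_eqF.
by rewrite vt tw.
Qed.

Lemma hat_node S l j : is_subdivision S -> (l < msub S)%N -> (j < msub S)%N ->
  hat (node S l) (node S l.+1) (node S l.+2) (node S j.+1) = (l == j)%:R.
Proof.
move=> hS lm jm; have [cS m1] := subdivision_size hS.
have lt1 : node S l < node S l.+1 by rewrite node_lt// cS !ltnS ltnW.
have lt2 : node S l.+1 < node S l.+2 by rewrite node_lt// cS !ltnS.
have [lj|jl|<-] := ltngtP l j.
- by rewrite hat_right// node_le// cS ltnS ltnW.
- by rewrite hat_left// node_le// cS ltnS ltnW// ltnW.
by rewrite hat_up ?lexx ?(ltW lt1)// divff// subr_eq0 gt_eqF.
Qed.

(** The kinks of a hat function are points of S, so that it is affine between
   two ends that enclose no point of S. *)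
Lemma hat_affine S l u v x : is_subdivision S -> (l < msub S)%N ->
  gap S u v -> u <= x <= v ->
  let phi := hat (node S l) (node S l.+1) (node S l.+2) in
  phi x = (1 - ratio u v x) * phi u + ratio u v x * phi v.
Proof.
move=> hS lm guv uxv phi; have [cS m1] := subdivision_size hS.
have lt1 : node S l < node S l.+1 by rewrite node_lt// cS !ltnS ltnW.
have lt2 : node S l.+1 < node S l.+2 by rewrite node_lt// cS !ltnS.
have n0 : node S l \in S by rewrite node_mem// cS ltnW// ltnW.
have n1 : node S l.+1 \in S by rewrite node_mem// cS ltnS ltnW.
have n2 : node S l.+2 \in S by rewrite node_mem// cS.
have /andP[ux xv] := uxv.
have [h2|h2] := guv _ n2.
  by rewrite /phi !hat_right//; lra.
have [h0|h0] := guv _ n0; last by rewrite /phi !hat_left//; lra.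
have [h1|h1] := guv _ n1.
  rewrite /phi !hat_down//; try (apply/andP; split; lra).
  by move: (ratio_mean uxv); move: (ratio u v x) => r <-; ring.
rewrite /phi !hat_up//; try (apply/andP; split; lra).
by move: (ratio_mean uxv); move: (ratio u v x) => r <-; ring.
Qed.

End subdivisions.

Section finite_extrema.
Context (R : realType).

Lemma seq_argmax (T : eqType) (s : seq T) (P : pred T) (g : T -> R) :
  (exists2 t, t \in s & P t) ->
  exists t, [/\ t \in s, P t & forall r, r \in s -> P r -> g r <= g t].
Proof.
elim: s => [[]//|a s ih] [t0 ts Pt].
have [[t ts' Pt']|no] := pselect (exists2 t, t \in s & P t); last first.
  move: ts; rewrite inE => /orP[/eqP ta|ts]; last by case: no; exists t0.
  exists a; split=> [||r]; [exact: mem_head|by rewrite -ta|].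
  by rewrite inE => /orP[/eqP->//|rs Pr]; case: no; exists r.
have [t1 [t1s Pt1 h1]] : exists t, [/\ t \in s, P t &
    forall r, r \in s -> P r -> g r <= g t] by apply: ih; exists t.
have [/andP[Pa gt]|h] := boolP (P a && (g t1 <= g a)).
  exists a; split=> // [|r]; first exact: mem_head.
  by rewrite inE => /orP[/eqP->//|rs Pr]; apply: le_trans gt; exact: h1.
exists t1; split=> // [|r]; first by rewrite inE t1s orbT.
rewrite inE => /orP[/eqP->|]; last exact: h1.
by move=> Pa; move: h; rewrite Pa /= -ltNge => /ltW.
Qed.

Lemma cell_exists (S : {fset R}) x : is_subdivision S -> 0 <= x <= 1 ->
  exists u v, [/\ u \in S, v \in S, 0 <= u /\ v <= 1, u <= x <= v & gap S u v].
Proof.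
move=> /is_subdivisionP[_ h0 h1 _ hS] x01.
have [|u [uS ux hu]] := @seq_argmax _ (enum_fset S) (fun t => t <= x) id.
  by exists 0 => //; lra.
have [|v [vS xv hv]] := @seq_argmax _ (enum_fset S) (fun t => x <= t) -%R.
  by exists 1 => //; lra.
exists u, v; split=> //.
- split; first by apply: hu => //; lra.
  by rewrite -lerN2; apply: hv => //; lra.
- by rewrite ux xv.
move=> s sS; have [sx|xs] := lerP s x; [left; exact: hu|right].
by rewrite -lerN2; apply: hv => //; exact: ltW.
Qed.

End finite_extrema.

(** * Multiaffine averages over boxes and grid interpolation *)

Section box_average.
Context (R : realType) (d : nat).
Implicit Types (u v : 'I_d -> R) (x z : cube R d) (f g : cube R d -> R).

(** The weights of x as a barycenter of the 2^d corners of a box, a product of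
   one-dimensional weights. Averaging over the corners is what multiaffine
   interpolation does inside a cell. *)
Definition box_weight u v x (c : {ffun 'I_d -> bool}) : R :=
  \prod_k (if c k then ratio (u k) (v k) (cube_coord x k)
           else 1 - ratio (u k) (v k) (cube_coord x k)).

Definition corner u v (c : {ffun 'I_d -> bool}) : cube R d :=
  to_cube (\row_k (if c k then v k else u k)).

Definition box_avg u v x f : R := \sum_c box_weight u v x c * f (corner u v c).

Definition in_box u v x :=
  forall k, [/\ 0 <= u k, v k <= 1 & u k <= cube_coord x k <= v k].

Variables (u v : 'I_d -> R) (x : cube R d).
Hypothesis hx : in_box u v x.

Lemma coord_corner c k : cube_coord (corner u v c) k = if c k then v k else u k.
Proof.
rewrite coord_row// => j; have [u0 v1 /andP[ux xv]] := hx j.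
by case: (c j); apply/andP; split; lra.
Qed.

Lemma box_weight_ge0 c : 0 <= box_weight u v x c.
Proof.
apply: prodr_ge0 => k _; have [_ _ /ratio01/andP[r0 r1]] := hx k.
by case: (c k); rewrite ?subr_ge0.
Qed.

Lemma box_avg_prod (g : 'I_d -> R -> R) :
  \sum_c box_weight u v x c * \prod_k g k (cube_coord (corner u v c) k) =
  \prod_k ((1 - ratio (u k) (v k) (cube_coord x k)) * g k (u k) +
           ratio (u k) (v k) (cube_coord x k) * g k (v k)).
Proof.
pose F k (b : bool) := (if b then ratio (u k) (v k) (cube_coord x k)
  else 1 - ratio (u k) (v k) (cube_coord x k)) * g k (if b then v k else u k).
transitivity (\prod_k \sum_b F k b); last first.
  by apply: eq_bigr => k _; rewrite big_bool addrC.
rewrite bigA_distr_bigA; apply: eq_bigr => c _; rewrite -big_split.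
by apply: eq_bigr => k _; rewrite coord_corner /F; case: (c k).
Qed.

Lemma sum_box_weight : \sum_c box_weight u v x c = 1.
Proof.
transitivity (\sum_c box_weight u v x c *
    \prod_k (fun _ _ => 1 : R) k (cube_coord (corner u v c) k)).
  by apply: eq_bigr => c _; rewrite big1// mulr1.
by rewrite (box_avg_prod (fun _ _ => 1)) big1// => k _; rewrite !mulr1 subrK.
Qed.

Lemma box_avg_le f (e : R) : (forall c, `|f (corner u v c)| <= e) ->
  `|box_avg u v x f| <= e.
Proof.
move=> hf; rewrite -[e]mul1r -sum_box_weight mulr_suml.
rewrite (le_trans (ler_norm_sum _ _ _))// ler_sum// => c _.
by rewrite normrM ger0_norm ?box_weight_ge0// ler_wpM2l ?box_weight_ge0.
Qed.

Lemma box_avg_sub f g : box_avg u v x f - box_avg u v x g = box_avg u v x (f \- g).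
Proof. by rewrite /box_avg -sumrB; apply: eq_bigr => c _; rewrite mulrBr. Qed.

Lemma box_avg_coord k (g : R -> R) :
  \sum_c box_weight u v x c * g (cube_coord (corner u v c) k) =
  (1 - ratio (u k) (v k) (cube_coord x k)) * g (u k) +
  ratio (u k) (v k) (cube_coord x k) * g (v k).
Proof.
pose G j : R -> R := if j == k then g else fun=> 1.
have Gk : G k = g by rewrite /G eqxx.
have Gj j : j != k -> G j = fun=> 1 by rewrite /G => /negPf ->.
transitivity (\sum_c box_weight u v x c * \prod_j G j (cube_coord (corner u v c) j)).
  apply: eq_bigr => c _; congr (_ * _).
  by rewrite (bigD1 k)//= Gk big1 ?mulr1// => j /Gj ->.
rewrite box_avg_prod (bigD1 k)//= Gk [X in _ * X]big1 ?mulr1// => j /Gj ->.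
by rewrite !mulr1 subrK.
Qed.

End box_average.

Section interpolation.
Context (R : realType) (d : nat) (S : 'I_d -> {fset R}).
Hypothesis hS : forall k, is_subdivision (S k).
Implicit Types (u v : 'I_d -> R) (x z : cube R d) (f g : cube R d -> R).
Implicit Types (l : multi_index S).

Lemma coord_knot l k : cube_coord (knot l) k = node (S k) (l k).+1.
Proof. by rewrite coord_row// => j; apply: node01. Qed.

Lemma coord_knot_mem l k : cube_coord (knot l) k \in S k.
Proof.
rewrite coord_knot node_mem//; have [-> _] := subdivision_size (hS k).
by rewrite ltnS ltnW// ltnS.
Qed.

Lemma knot_of_mem x : (forall k, cube_coord x k \in S k) ->
  exists l : multi_index S, knot l = x.
Proof.
move=> hx.
have h k : {l : 'I_(msub (S k)) | node (S k) l.+1 = cube_coord x k}.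
  apply: cid; have [l lm ln] := node_of_mem (hS k) (hx k) (coord01 x k).
  by exists (Ordinal lm).
exists [ffun k => sval (h k)]; apply: cube_ext => k.
by rewrite coord_knot ffunE; exact: (svalP (h k)).
Qed.

Lemma basis_fun_knot l l' : basis_fun l (knot l') = (l == l')%:R.
Proof.
have E k : hat (node (S k) (l k)) (node (S k) (l k).+1) (node (S k) (l k).+2)
    (cube_coord (knot l') k) = (l k == l' k)%:R.
  by rewrite coord_knot hat_node.
rewrite /basis_fun; under eq_bigr do rewrite E.
have [->|ll'] := eqVneq l l'; first by rewrite big1// => k _; rewrite eqxx.
have [k kl] : exists k, l k != l' k.
  apply/existsP; apply: contraT => /existsPn h; case/eqP: ll'.
  by apply/ffunP => k; apply/eqP; have := h k; rewrite negbK.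
by rewrite (bigD1 k)//= (negPf kl) mul0r.
Qed.

Lemma interpolant_knot f l : interpolant S f (knot l) = f (knot l).
Proof.
rewrite /interpolant (bigD1 l)//= basis_fun_knot eqxx mulr1 big1 ?addr0//.
by move=> l' /negPf h; rewrite basis_fun_knot h mulr0.
Qed.

Lemma interpolant_mem f x : (forall k, cube_coord x k \in S k) ->
  interpolant S f x = f x.
Proof. by move=> /knot_of_mem[l <-]; exact: interpolant_knot. Qed.

Lemma eq_interpolant f g : (forall l : multi_index S, f (knot l) = g (knot l)) ->
  interpolant S f = interpolant S g.
Proof. by move=> fg; apply/funext => x; apply: eq_bigr => l _; rewrite fg. Qed.

Lemma interpolant_add f g : interpolant S (f \+ g) = interpolant S f \+ interpolant S g.
Proof.
apply/funext => x; rewrite /= /interpolant -big_split.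
by apply: eq_bigr => l _; rewrite mulrDl.
Qed.

Lemma interpolant_scale a f : interpolant S (a \*o f) = a \*o interpolant S f.
Proof.
apply/funext => x; rewrite /= /interpolant mulr_sumr.
by apply: eq_bigr => l _; rewrite mulrA.
Qed.

Lemma interpolant_sub f g : interpolant S (f \- g) = interpolant S f \- interpolant S g.
Proof. by rewrite sub_addN interpolant_add interpolant_scale -sub_addN. Qed.

(** Inside a box without knots the interpolant is multiaffine, hence equal to
   its own average over the corners. *)
Lemma interpolant_box u v x f : in_box u v x -> (forall k, gap (S k) (u k) (v k)) ->
  box_avg u v x (interpolant S f) = interpolant S f x.
Proof.
move=> hx hg; rewrite /box_avg /interpolant.
under eq_bigr do rewrite mulr_sumr.
rewrite exchange_big; apply: eq_bigr => l _ /=.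
under eq_bigr do rewrite mulrCA.
rewrite -mulr_sumr; congr (_ * _).
rewrite /basis_fun (box_avg_prod hx (fun k => hat (node (S k) (l k))
  (node (S k) (l k).+1) (node (S k) (l k).+2))).
by apply: eq_bigr => k _; rewrite -hat_affine//; have [] := hx k.
Qed.

Lemma cell_box x : exists u v, [/\ in_box u v x,
  forall k, gap (S k) (u k) (v k), forall k, u k \in S k & forall k, v k \in S k].
Proof.
have h k : exists uv : R * R, [/\ uv.1 \in S k, uv.2 \in S k, 0 <= uv.1 /\ uv.2 <= 1,
    uv.1 <= cube_coord x k <= uv.2 & gap (S k) uv.1 uv.2].
  by have [u [v h]] := cell_exists (hS k) (coord01 x k); exists (u, v).
have [uv huv] := choice h.
exists (fun k => (uv k).1), (fun k => (uv k).2).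
by split=> [k|k|k|k]; have [? ? [? ?] ? ?] := huv k.
Qed.

Lemma interpolant_cell x : exists u v, [/\ in_box u v x, forall k, u k \in S k,
  forall k, v k \in S k & forall f, interpolant S f x = box_avg u v x f].
Proof.
have [u [v [hx hg hu hv]]] := cell_box x; exists u, v; split=> // f.
rewrite -(interpolant_box f hx hg); apply: eq_bigr => c _; congr (_ * _).
by apply: interpolant_mem => k; rewrite (coord_corner hx); case: (c k).
Qed.

Lemma interpolant_le f x (e : R) : (forall l : multi_index S, `|f (knot l)| <= e) ->
  `|interpolant S f x| <= e.
Proof.
have [u [v [hx hu hv ->]]] := interpolant_cell x => hf.
apply: (box_avg_le hx) => c; have [|l <-] := @knot_of_mem (corner u v c).
  by move=> k; rewrite (coord_corner hx); case: (c k).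
exact: hf.
Qed.

(** In one coordinate the mean distance from z to the ends u, v of its cell is
   2 (z - u) (v - z) / (v - u), at most twice the distance to the nearer end. *)
Lemma interpolant_error f z (t : 'I_d -> R) (e C : R) : 0 <= C ->
  (forall k, t k \in S k) ->
  (forall x, `|f x - f z| <= e + C * \sum_k `|cube_coord x k - cube_coord z k|) ->
  `|f z - interpolant S f z| <= e + 2 * C * \sum_k `|cube_coord z k - t k|.
Proof.
move=> C0 ht hf; have [u [v [hx hg hu hv]]] := cell_box z.
have fz : f z = box_avg u v z (fun=> f z).
  by rewrite /box_avg -mulr_suml (sum_box_weight hx) mul1r.
have -> : interpolant S f z = box_avg u v z f.
  rewrite -(interpolant_box f hx hg); apply: eq_bigr => c _; congr (_ * _).
  by apply: interpolant_mem => k; rewrite (coord_corner hx); case: (c k).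
rewrite distrC {1}fz box_avg_sub /box_avg (le_trans (ler_norm_sum _ _ _))//.
pose w c := box_weight u v z c.
apply: (@le_trans _ _ (\sum_c (w c * e +
  C * \sum_k w c * `|cube_coord (corner u v c) k - cube_coord z k|))).
  apply: ler_sum => c _; rewrite normrM (ger0_norm (box_weight_ge0 hx c)).
  apply: le_trans (ler_wpM2l (box_weight_ge0 hx c) (hf (corner u v c))) _.
  by rewrite mulrDr mulrCA -[in leRHS]mulr_sumr.
rewrite big_split -mulr_suml (sum_box_weight hx) mul1r lerD2l -mulr_sumr.
rewrite -mulrA mulrCA ler_wpM2l// exchange_big mulr_sumr; apply: ler_sum => k _.
rewrite (box_avg_coord hx k (fun s => `|s - cube_coord z k|)).
have [_ _ uzv] := hx k; have /andP[uz zv] := uzv.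
have := ratio_mean uzv; have := ratio01 uzv.
move: (cube_coord z k) (ratio _ _ _) uz zv => s r uz zv /andP[r0 r1] mean.
rewrite ler0_norm ?subr_le0// ger0_norm ?subr_ge0//.
have [tu|vt] := hg k _ (ht k).
  have : s - u k <= `|s - t k| by apply: le_trans (ler_norm _); lra.
  nra.
have : v k - s <= `|s - t k|.
  by rewrite distrC; apply: le_trans (ler_norm _); lra.
nra.
Qed.

End interpolation.

Section refinement.
Context (R : realType) (d : nat) (S S' : 'I_d -> {fset R}).
Hypothesis hS : forall k, is_subdivision (S k).
Hypothesis hS' : forall k, is_subdivision (S' k).
Hypothesis SS' : forall k, (S k `<=` S' k)%fset.

(** A cell of the fine grid lies in a cell of the coarse one, where the coarse
   interpolant is multiaffine. *)
Lemma interpolant_fine f : interpolant S' (interpolant S f) = interpolant S f.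
Proof.
apply/funext => x; have [u [v [hx hg hu hv]]] := cell_box hS' x.
rewrite -(interpolant_box hS' _ hx hg).
rewrite -[RHS](interpolant_box hS _ hx); last first.
  by move=> k s /(fsubsetP (SS' k)); exact: hg.
apply: eq_bigr => c _; congr (_ * _).
by apply: interpolant_mem => // k; rewrite (coord_corner hx); case: (c k).
Qed.

Lemma interpolant_coarse f : interpolant S (interpolant S' f) = interpolant S f.
Proof.
apply: eq_interpolant => l; apply: interpolant_mem => // k.
by apply: (fsubsetP (SS' k)); exact: coord_knot_mem.
Qed.

End refinement.

(** * Stability of constrained minimizers in an RKHS *)

Lemma almost_monotone_cvg (R : realType) (nu : nat -> R) (B : R) :
  (forall p, 0 <= nu p) ->
  (exists N, forall p, (N <= p)%N -> nu p <= B) ->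
  (forall e : R, 0 < e -> exists N, forall p q, (N <= p)%N -> (p <= q)%N ->
     nu p <= nu q + e) ->
  exists d, tends_to nu d.
Proof.
move=> nu0 [N0 hB] mono.
pose D := [set r : R | exists N, forall p, (N <= p)%N -> nu p <= r].
have hi : has_inf D.
  split; first by exists B, N0.
  by exists 0 => r [N hN]; apply: le_trans (hN N (leqnn N)).
exists (inf D) => e e0.
have [r [N1 h1] lt1] := inf_adherent e0 hi.
have e20 : 0 < e / 2 by lra.
have [N2 h2] := mono _ e20.
have [p N2p hp] : exists2 p, (N2 <= p)%N & inf D - e / 2 < nu p.
  apply: contrapT => no; have : inf D <= inf D - e / 2; last lra.
  apply: ge_inf; first by case: hi.
  exists N2 => p N2p; rewrite leNgt; apply/negP => hp.
  by apply: no; exists p.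
exists (maxn N1 p) => q; rewrite geq_max => /andP[N1q pq].
have := h1 q N1q; have := h2 p q N2p pq; rewrite ler_distl => ? ?.
by apply/andP; split; lra.
Qed.

Lemma div_succ_mul_le (R : realType) (a c : R) : 0 <= a -> 0 <= c ->
  a / (c + 1) * c <= a.
Proof.
move=> a0 c0; have -> : a / (c + 1) * c = a - a / (c + 1).
  by field; rewrite gt_eqF//; lra.
by rewrite gerBl divr_ge0//; lra.
Qed.

Section stability.
Context (R : realType) (T : Type) (k : T -> T -> R) (H : rkhs k) (n : nat).
Local Notation nrm := (rkhs_norm H).
Local Notation mem := (rkhs_space H).

Variables (E : nat -> set (T -> R)) (ev : nat -> (T -> R) -> 'I_n -> R).
Variables (evl : (T -> R) -> 'I_n -> R) (y : 'I_n -> R).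
Variables (g : T -> R) (rho : R) (w : 'I_n -> T -> R) (h : nat -> T -> R).
Hypothesis E_dec : forall p q, (p <= q)%N -> E q `<=` E p.
Hypothesis E_conv : forall p, convex_functions (E p).
Hypothesis ev_add : forall p f1 f2 i, ev p (f1 \+ f2) i = ev p f1 i + ev p f2 i.
Hypothesis ev_scale : forall p a f i, ev p (a \*o f) i = a * ev p f i.
Hypothesis ev_close : forall e : R, 0 < e -> exists N, forall p, (N <= p)%N ->
  forall f i, mem f -> `|ev p f i - evl f i| <= e * nrm f.
Hypothesis g_mem : mem g.
Hypothesis rho_gt0 : 0 < rho.
Hypothesis g_int : forall p f, mem f -> nrm (f \- g) < rho -> E p f.
Hypothesis g_ev : forall i, evl g i = y i.
Hypothesis w_mem : forall j, mem (w j).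
Hypothesis w_ev : forall j i, evl (w j) i = (j == i)%:R.
Hypothesis h_mem : forall p, mem (h p).
Hypothesis h_E : forall p, E p (h p).
Hypothesis h_ev : forall p i, ev p (h p) i = y i.
Hypothesis h_min : forall p f, mem f -> E p f -> (forall i, ev p f i = y i) ->
  nrm (h p) <= nrm f.

Lemma ev_sum p (c : 'I_n -> R) (F : 'I_n -> T -> R) i :
  ev p (fun x => \sum_j c j * F j x) i = \sum_j c j * ev p (F j) i.
Proof.
elim: (index_enum _) => [|j r ih].
  rewrite big_nil -[RHS](mul0r (ev p g i)) -ev_scale; congr (ev p _ i).
  by apply/funext => x; rewrite big_nil /= mul0r.
rewrite big_cons -ih -ev_scale -ev_add; congr (ev p _ i).
by apply/funext => x; rewrite big_cons.
Qed.

(** On the span of the dual family w the matrix of the evaluations tends to the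
   identity, hence is eventually invertible with a uniform bound. *)
Lemma ev_correct : exists K : R, 0 <= K /\ exists N, forall p, (N <= p)%N ->
  forall (r : 'I_n -> R) (delta : R), (forall i, `|r i| <= delta) ->
  exists v, [/\ mem v, forall i, ev p v i = r i & nrm v <= K * delta].
Proof.
pose W := \sum_j nrm (w j).
have W0 : 0 <= W by apply: sumr_ge0 => j _; exact: norm_ge0.
have wW j : nrm (w j) <= W.
  by rewrite /W (bigD1 j)//= lerDl sumr_ge0// => i _; exact: norm_ge0.
exists (2 * n%:R * W); split; first by rewrite !mulr_ge0.
pose q : R := (2 * n.+1%:R)^-1.
have q0 : 0 < q by rewrite invr_gt0 mulr_gt0.
have [N hN] := ev_close (divr_gt0 q0 (ltr_pwDr ltr01 W0)).
exists N => p /hN {}hN r delta hr.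
pose A : 'M[R]_n := \matrix_(j, i) ev p (w j) i.
have A1 j i : `|A j i - (j == i)%:R| <= q.
  rewrite mxE -w_ev; apply: le_trans (hN (w j) i (w_mem j)) _.
  rewrite -[leRHS](divfK (_ : W + 1 != 0)); last by rewrite gt_eqF; lra.
  by rewrite ler_wpM2l ?divr_ge0 ?(ltW q0)//; have := wW j; lra.
have near1 (c : 'rV[R]_n) (s := \sum_j `|c 0 j|) i : `|(c *m A) 0 i - c 0 i| <= s * q.
  have -> : (c *m A) 0 i - c 0 i = \sum_j c 0 j * (A j i - (j == i)%:R).
    rewrite mxE; under [RHS]eq_bigr do rewrite mulrBr.
    rewrite sumrB; congr (_ - _); rewrite (bigD1 i)//= eqxx mulr1 big1 ?addr0//.
    by move=> j /negPf ->; rewrite mulr0.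
  rewrite (le_trans (ler_norm_sum _ _ _))// mulr_suml ler_sum// => j _.
  by rewrite normrM ler_wpM2l.
have bound (c : 'rV[R]_n) (D : R) : (forall i, `|(c *m A) 0 i| <= D) ->
    \sum_j `|c 0 j| <= 2 * n%:R * D.
  move=> hD; have := near1 c; set s := \sum_j _ => /= near.
  have : s <= \sum_(j < n) (D + s * q).
    apply: ler_sum => j _; have := near j; rewrite distrC => ns.
    by have := ler_normD (c 0 j - (c *m A) 0 j) ((c *m A) 0 j); rewrite subrK;
      have := hD j; lra.
  rewrite sumr_const card_ord -mulr_natl => hs.
  have s0 : 0 <= s by apply: sumr_ge0.
  have nq : n%:R * q <= 1 / 2.
    rewrite /q ler_pdivrMr ?mulr_gt0// -(natr1 n); lra.
  have n0 : 0 <= n%:R :> R by [].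
  nra.
have Au : A \in unitmx.
  rewrite -row_free_unit; apply: inj_row_free => c cA.
  have /bound h0 : forall i, `|(c *m A) 0 i| <= 0 by move=> i; rewrite cA mxE normr0.
  apply/rowP => j; rewrite mxE; apply/eqP; rewrite -normr_le0.
  apply: le_trans (_ : _ <= \sum_j `|c 0 j|) _; last by rewrite mulr0 in h0.
  by rewrite (bigD1 j)//= lerDl sumr_ge0.
pose c : 'rV[R]_n := (\row_i r i) *m invmx A.
have cA i : (c *m A) 0 i = r i by rewrite mulmxKV// mxE.
exists (fun x => \sum_j c 0 j * w j x); split.
- exact: mem_sum.
- by move=> i; rewrite ev_sum -cA [RHS]mxE; apply: eq_bigr => j _; rewrite [A j i]mxE.
apply: le_trans (norm_sum _ _ w_mem) _.
apply: (@le_trans _ _ ((\sum_j `|c 0 j|) * W)).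
  by rewrite mulr_suml ler_sum// => j _; rewrite ler_wpM2l.
rewrite mulrAC ler_wpM2r// bound// => i; by rewrite cA.
Qed.

(** Mixing z with the interior point g creates the room that the correction
   of the interpolation residual needs. *)
Lemma near_feasible (e : R) : 0 < e -> exists N, exists2 eta : R, 0 < eta &
  forall p z, (N <= p)%N -> mem z -> E p z ->
    (forall i, `|ev p z i - y i| <= eta) -> nrm (h p) <= nrm z + e.
Proof.
move=> e0; have [K [K0 [N1 hK]]] := ev_correct.
pose G := nrm g; have G0 : 0 <= G by exact: norm_ge0.
pose s := Num.min 1 (e / (2 * (G + 1))).
have s0 : 0 < s by rewrite lt_min ltr01 divr_gt0//; lra.
have s1 : s <= 1 by rewrite ge_min lexx.
have sG : s * G <= e / 2.
  have : s * (2 * (G + 1)) <= e.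
    by rewrite -ler_pdivlMr; [rewrite ge_min lexx orbT|lra].
  nra.
pose m := Num.min (e / 2) (s * rho / 2).
have m0 : 0 < m by rewrite lt_min !divr_gt0 ?mulr_gt0.
have me : m <= e / 2 by rewrite ge_min lexx.
have mr : m < s * rho.
  apply: (@le_lt_trans _ _ (s * rho / 2)); first by rewrite ge_min lexx orbT.
  have : 0 < s * rho by rewrite mulr_gt0.
  lra.
pose delta := m / (K + 1).
have d0 : 0 < delta by rewrite divr_gt0//; lra.
have Kd : K * delta <= m.
  have <- : delta * (K + 1) = m by rewrite divfK// gt_eqF//; lra.
  nra.
have d20 : 0 < delta / 2 / (G + 1) by rewrite !divr_gt0//; lra.
have [N2 hN2] := ev_close d20.
exists (maxn N1 N2), (delta / 2); first lra.
move=> p z; rewrite geq_max => /andP[N1p N2p] hz Ez zy.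
pose zs := ((1 - s) \*o z) \+ (s \*o g).
have hzs : mem zs by apply: mem_add; exact: mem_scale.
have ball f : mem f -> nrm (f \- zs) < s * rho -> E p f.
  move=> hf fr; pose f' := g \+ (s^-1 \*o (f \- zs)).
  have hfz := mem_sub hf hzs.
  have hf' : mem f' by apply: mem_add => //; exact: mem_scale.
  have Ef' : E p f'.
    apply: g_int => //.
    have -> : f' \- g = s^-1 \*o (f \- zs).
      by apply/funext => x; rewrite /f' /= addrAC subrr add0r.
    rewrite norm_scale// ger0_norm ?invr_ge0 ?ltW// mulrC ltr_pdivrMr//.
    by rewrite mulrC.
  have s01 : 0 <= 1 - s <= 1 by lra.
  have := E_conv Ez Ef' s01; congr (E p _); apply/funext => x.
  rewrite /f' /= /zs /=; field; by rewrite gt_eqF.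
have res i : `|y i - ev p zs i| <= delta.
  rewrite /zs ev_add !ev_scale.
  have := hN2 p N2p g i g_mem; rewrite g_ev -/G => hg.
  have {}hg : `|ev p g i - y i| <= delta / 2.
    by apply: le_trans hg _; apply: div_succ_mul_le => //; lra.
  have := zy i; move: hg; rewrite !ler_norml => /andP[? ?] /andP[? ?].
  by apply/andP; split; nra.
have [v [hv evv nv]] := hK p N1p _ _ res.
have hzv : mem (zs \+ v) by exact: mem_add.
have zvE : E p (zs \+ v).
  apply: ball => //; have -> : (zs \+ v) \- zs = v.
    by apply/funext => x; rewrite /= addrAC subrr add0r.
  by apply: le_lt_trans mr; exact: le_trans nv _.
apply: (le_trans (h_min hzv zvE _)).
  by move=> i; rewrite ev_add evv addrC subrK.
apply: (le_trans (norm_triangle hzs hv)).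
have := norm_triangle (mem_scale (1 - s) hz) (mem_scale s g_mem).
rewrite -/zs !norm_scale// -/G (ger0_norm (ltW s0)) ger0_norm ?subr_ge0//.
have := norm_ge0 H z; move: (nrm zs) (nrm z) (nrm v) nv => a b c nv b0 ab.
nra.
Qed.

Lemma minimizers_norm_le (f : T -> R) (e : R) : mem f -> (forall p, E p f) ->
  (forall i, evl f i = y i) -> 0 < e ->
  exists N, forall p, (N <= p)%N -> nrm (h p) <= nrm f + e.
Proof.
move=> hf Ef fy e0; have [N [eta eta0 hN]] := near_feasible e0.
have f0 := norm_ge0 H f.
have eta1 : 0 < eta / (nrm f + 1) by rewrite divr_gt0//; lra.
have [N' hN'] := ev_close eta1.
exists (maxn N N') => p; rewrite geq_max => /andP[Np N'p]; apply: hN => // i.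
rewrite -fy; apply: le_trans (hN' p N'p f i hf) _.
by apply: div_succ_mul_le => //; exact: ltW.
Qed.

(** The constraint sets E decrease, but the interpolation conditions ev p
   move with p, so that the minimal norms are only almost monotone. Comparing
   h p, for p <= q, with h q and with the midpoint of h p and h q, which are both
   almost feasible at rank p, gives that the norms converge and that the
   sequence is Cauchy. *)
Theorem minimizers_cvg : exists2 hl, mem hl &
  tends_to (fun p => nrm (h p \- hl)) 0 /\
  forall f, mem f -> (forall p, E p f) -> (forall i, evl f i = y i) ->
    nrm hl <= nrm f.
Proof.
have gE p : E p g.
  apply: g_int => //; have -> : g \- g = fun=> 0.
    by apply/funext => x; rewrite /= subrr.
  by rewrite norm0.
have [N0 hN0] := minimizers_norm_le g_mem gE g_ev ltr01.
pose B := nrm g + 1; have B0 : 0 < B by rewrite ltr_wpDl ?norm_ge0.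
have close (e : R) : 0 < e -> exists N, forall p q, (N <= p)%N -> (p <= q)%N ->
    forall i, `|ev p (h q) i - y i| <= e.
  move=> e0; have e1 : 0 < e / (2 * B) by rewrite divr_gt0//; lra.
  have [N hN] := ev_close e1; exists (maxn N0 N) => p q.
  rewrite geq_max => /andP[N0p Np] pq i; rewrite -(h_ev q i).
  have hB : nrm (h q) <= B by apply: hN0; exact: leq_trans pq.
  have le2 : e / (2 * B) * nrm (h q) <= e / 2.
    have -> : e / 2 = e / (2 * B) * B by field; rewrite gt_eqF.
    by rewrite ler_wpM2l// ltW.
  have := hN p Np (h q) i (h_mem q).
  have := hN q (leq_trans Np pq) (h q) i (h_mem q).
  rewrite distrC => h1 h2; apply: le_trans (ler_distD (evl (h q) i) _ _) _.
  lra.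
have step (e : R) : 0 < e -> exists N, forall p q, (N <= p)%N -> (p <= q)%N ->
    nrm (h p) <= nrm (h q) + e /\ 2 * nrm (h p) - e <= nrm (h p \+ h q).
  move=> e0; have e20 : 0 < e / 2 by lra.
  have [N [eta eta0 hN]] := near_feasible e20; have [N' hN'] := close _ eta0.
  exists (maxn N N') => p q; rewrite geq_max => /andP[Np N'p] pq.
  have Eq : E p (h q) by exact: E_dec pq _ (h_E q).
  split.
    have := hN p (h q) Np (h_mem q) Eq (hN' p q N'p pq); lra.
  have hmid := mem_scale 2^-1 (mem_add (h_mem p) (h_mem q)).
  have := hN p (2^-1 \*o (h p \+ h q)) Np hmid.
  rewrite norm_scale; last exact: mem_add.
  rewrite ger0_norm ?invr_ge0// => hmin.
  suff : nrm (h p) <= 2^-1 * nrm (h p \+ h q) + e / 2 by lra.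
  apply: hmin.
    have half : 0 <= (2^-1 : R) <= 1 by lra.
    have := E_conv (h_E p) Eq half; congr (E p _); apply/funext => x /=; lra.
  move=> i; rewrite ev_scale ev_add h_ev.
  have := hN' p q N'p pq i; rewrite !ler_norml => /andP[? ?].
  by apply/andP; split; lra.
have [d hd] : exists d, tends_to (fun p => nrm (h p)) d.
  apply: (@almost_monotone_cvg _ _ B).
  - by move=> p; exact: norm_ge0.
  - by exists N0.
  - move=> e e0; have [N hN] := step e e0; exists N => p q Np pq.
    by have [] := hN p q Np pq.
have [|hl hhl cvl] := minimizing_cauchy h_mem hd.
  move=> e e0; have e40 : 0 < e / 4 by lra.
  have [N hN] := step _ e40; have [N' hN'] := hd _ e40.
  exists (maxn N N') => p q; rewrite geq_max => /andP[Np N'p] pq.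
  have [_] := hN p q Np pq; have := hN' p N'p.
  by rewrite ler_distl => /andP[]; lra.
exists hl => //; split=> // f hf Ef fy; apply/ler_addgt0Pr => e e0.
have e20 : 0 < e / 2 by lra.
have [N hN] := minimizers_norm_le hf Ef fy e20.
have [N' hN'] := tends_to0_le cvl e20.
have := hN _ (leq_maxl N N'); have := hN' _ (leq_maxr N N').
move: (maxn N N') => p h1 h2.
have := norm_dist hhl (h_mem p); rewrite norm_subC// ler_distl => /andP[_ h3].
lra.
Qed.

End stability.

(** * Nested subdivisions *)

Section nested_subdivisions.
Context (R : realType).

Lemma nested_le (S : nat -> {fset R}) : (forall m, (S m `<=` S m.+1)%fset) ->
  forall m m', (m <= m')%N -> (S m `<=` S m')%fset.
Proof.
move=> nest m m' /subnK <-; elim: (m' - m)%N => [|j ih]; first exact: fsubset_refl.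
by rewrite addSn; exact: fsubset_trans ih (nest _).
Qed.

(** Cut [0,1] into intervals of length eta: each one that some S m meets is
   met from a certain rank on. *)
Lemma nested_dense (S : nat -> {fset R}) (eta : R) :
  (forall m, (S m `<=` S m.+1)%fset) -> 0 < eta ->
  exists M, forall m m', (M <= m)%N -> forall t, t \in S m' -> 0 <= t <= 1 ->
    exists2 s, s \in S m & `|t - s| <= eta.
Proof.
move=> nest eta0.
pose bin t := Num.truncn (t / eta).
have h (i : 'I_(bin 1).+1) : exists M, forall m' t, t \in S m' -> 0 <= t <= 1 ->
    bin t = i -> exists s, [/\ s \in S M, 0 <= s <= 1 & bin s = i].
  have [[[m' s] [sS s01 si]]|no] := pselect (exists p : nat * R,
      [/\ p.2 \in S p.1, 0 <= p.2 <= 1 & bin p.2 = i]).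
    by exists m' => ? ? _ _ _; exists s.
  by exists 0%N => m' t tS t01 ti; case: no; exists (m', t).
have [M hM] := choice h.
exists (\max_i M i)%N => m m' Mm t tS t01.
have bt : (bin t < (bin 1%R).+1)%N.
  rewrite ltnS; apply: Num.Theory.le_truncn.
  by rewrite ler_pM2r ?invr_gt0//; lra.
have [s [sS s01 st]] := hM (Ordinal bt) m' t tS t01 erefl.
exists s.
  apply: (fsubsetP (nested_le nest _)) sS.
  by apply: leq_trans Mm; exact: leq_bigmax.
have bd r : 0 <= r <= 1 -> (bin r)%:R * eta <= r < (bin r)%:R * eta + eta.
  move=> r01; have : 0 <= r / eta by apply: divr_ge0; lra.
  move=> /Num.Theory.truncn_itv; rewrite -/(bin r) -natr1.
  by rewrite ler_pdivlMr// ltr_pdivrMr// mulrDl mul1r.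
have := bd t t01; have := bd s s01; rewrite st /= => /andP[? ?] /andP[? ?].
by rewrite ler_norml; apply/andP; split; lra.
Qed.

Lemma nested_dense_family (d : nat) (S : nat -> 'I_d -> {fset R}) (eta : R) :
  (forall m k, (S m k `<=` S m.+1 k)%fset) -> 0 < eta ->
  exists M, forall m m', (M <= m)%N -> forall k t, t \in S m' k -> 0 <= t <= 1 ->
    exists2 s, s \in S m k & `|t - s| <= eta.
Proof.
move=> nest eta0.
have h k := @nested_dense (fun m => S m k) eta (fun m => nest m k) eta0.
have [M hM] := choice h.
exists (\max_k M k)%N => m m' Mm k; apply: hM.
by apply: leq_trans Mm; exact: leq_bigmax.
Qed.

(** The cells of x shrink to a limit cell, whose ends are limits of knots: its
   left end is the supremum of all knots before x, and symmetrically. *)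
Lemma limit_cell (S : nat -> {fset R}) x :
  (forall m, is_subdivision (S m)) -> 0 <= x <= 1 ->
  exists uv : R * R, [/\ 0 <= uv.1, uv.2 <= 1, uv.1 <= x <= uv.2,
    forall m, gap (S m) uv.1 uv.2 &
    forall (r eta : R), r = uv.1 \/ r = uv.2 -> 0 < eta ->
      exists m, exists s, [/\ s \in S m, 0 <= s <= 1 & `|r - s| <= eta]].
Proof.
move=> hS x01.
have h0 m : 0 \in S m by have /is_subdivisionP[] := hS m.
have h1 m : 1 \in S m by have /is_subdivisionP[] := hS m.
have h01 m s : s \in S m -> [\/ s = -1, s = 2 | 0 <= s <= 1].
  by have /is_subdivisionP[_ _ _ _] := hS m; apply.
pose A := [set s | exists m, s \in S m /\ 0 <= s <= x].
pose B := [set s | exists m, s \in S m /\ x <= s <= 1].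
have A0 : A 0 by exists 0%N; split=> //; lra.
have B1 : B 1 by exists 0%N; split=> //; lra.
have hA : has_sup A by split; [exists 0|exists x => s [m [_ /andP[]]]].
have hB : has_inf B by split; [exists 1|exists x => s [m [_ /andP[]]]].
exists (sup A, inf B); split=> /=.
- by apply: ub_le_sup => //; case: hA.
- by apply: ge_inf => //; case: hB.
- apply/andP; split; first by apply: ge_sup; [exists 0|move=> s [m [_ /andP[]]]].
  by apply: lb_le_inf; [exists 1|move=> s [m [_ /andP[]]]].
- move=> m s sS; have [sx|xs] := lerP s x.
    left; have [s0|s0] := lerP 0 s.
      by apply: ub_le_sup; [case: hA|exists m; split=> //; rewrite s0].
    by apply: (le_trans (ltW s0)); apply: ub_le_sup => //; case: hA.
  right; have [s1|s1] := lerP s 1.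
    by apply: ge_inf; [case: hB|exists m; split=> //; rewrite (ltW xs)].
  by apply: le_trans (ltW s1); apply: ge_inf => //; case: hB.
move=> r eta [] -> eta0.
  have [s [m [sS /andP[s0 sx]]] hs] := sup_adherent eta0 hA.
  have su : s <= sup A.
    by apply: ub_le_sup; [case: hA|exists m; split=> //; rewrite s0].
  exists m, s; split=> //; first by lra.
  by rewrite ger0_norm; lra.
have [s [m [sS /andP[s0 sx]]] hs] := inf_adherent eta0 hB.
have su : inf B <= s.
  by apply: ge_inf; [case: hB|exists m; split=> //; rewrite s0].
exists m, s; split=> //; first by lra.
by rewrite ler0_norm; lra.
Qed.

End nested_subdivisions.

(** * The finite-dimensional mode as an RKHS minimizer *)

Definition uniformly_closed (R : realType) (T : Type) (C : set (T -> R)) :=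
  forall (u : nat -> T -> R) f, (forall p, C (u p)) ->
    (forall e : R, 0 < e -> exists N, forall p, (N <= p)%N ->
       forall x, `|u p x - f x| <= e) -> C f.

Section finite_mode.
Context (R : realType) (d : nat) (k : cube R d -> cube R d -> R) (H : rkhs k).
Context (S : 'I_d -> {fset R}).
Hypothesis hS : forall j, is_subdivision (S j).
Hypothesis gram_unit : gram k S \in unitmx.
Local Notation nrm := (rkhs_norm H).
Local Notation mem := (rkhs_space H).
Implicit Types (alpha beta : coefs S) (f : cube R d -> R).

Definition knotp (p : 'I_#|{: multi_index S}|) : cube R d := knot (enum_val p).

Definition grid_values f : coefs S := \col_p f (knotp p).

(** The element of minimal norm with the prescribed grid values. *)
Definition gram_fun alpha : cube R d -> R :=
  fun x => \sum_p (invmx (gram k S) *m alpha) p 0 * k x (knotp p).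

Lemma Yfun_interpolant alpha f : (forall p, f (knotp p) = alpha p 0) ->
  Yfun alpha = interpolant S f.
Proof.
move=> fa; apply/funext => x; apply: eq_bigr => l _.
by rewrite -fa /knotp enum_rankK.
Qed.

Lemma Yfun_grid_values f : Yfun (grid_values f) = interpolant S f.
Proof. by apply: Yfun_interpolant => p; rewrite mxE. Qed.

Lemma gram_fun_mem alpha : mem (gram_fun alpha).
Proof.
by apply: (mem_sum _ _ (F := fun p => k^~ (knotp p))) => p; exact: kernel_mem.
Qed.

Lemma gram_fun_knot alpha p : gram_fun alpha (knotp p) = alpha p 0.
Proof.
rewrite -[in RHS](mulKVmx gram_unit alpha) mxE; apply: eq_bigr => q _.
by rewrite [gram k S p q]mxE mulrC.
Qed.

Lemma ip_gram_fun f alpha : mem f ->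
  rkhs_ip H f (gram_fun alpha) =
  \sum_p (invmx (gram k S) *m alpha) p 0 * f (knotp p).
Proof.
move=> hf; rewrite rkhs_ip_sym//; last exact: gram_fun_mem.
rewrite (ip_suml _ _ (F := fun p => k^~ (knotp p)))//; last by move=> p; exact: kernel_mem.
apply: eq_bigr => p _; congr (_ * _); rewrite rkhs_ip_sym//; last exact: kernel_mem.
by rewrite -rkhs_reproducing.
Qed.

Lemma norm_gram_fun alpha :
  nrm (gram_fun alpha) ^+ 2 = (alpha^T *m invmx (gram k S) *m alpha) 0 0.
Proof.
rewrite norm_sq ?ip_gram_fun//; try exact: gram_fun_mem.
rewrite -mulmxA mxE; apply: eq_bigr => p _.
by rewrite gram_fun_knot mulrC [alpha^T _ _]mxE.
Qed.

(** The difference f - gram_fun vanishes on the grid, hence is orthogonal to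
   the kernel sections at the knots. *)
Lemma gram_fun_min f : mem f -> nrm (gram_fun (grid_values f)) <= nrm f.
Proof.
move=> hf; pose v := grid_values f; pose h := gram_fun v.
have hh : mem h by exact: gram_fun_mem.
have E : rkhs_ip H h h = rkhs_ip H f h.
  by rewrite !ip_gram_fun//; apply: eq_bigr => p _; rewrite /h gram_fun_knot [v _ _]mxE.
have : nrm h ^+ 2 <= nrm f * nrm h.
  rewrite norm_sq// E; exact: le_trans (ler_norm _) (cauchy_schwarz hf hh).
rewrite -/v -/h.
have [->|h0] := eqVneq (nrm h) 0; first by rewrite norm_ge0.
by rewrite expr2 ler_pM2r// lt0r h0 norm_ge0.
Qed.

Lemma gram_fun_add alpha beta : gram_fun (alpha + beta) = gram_fun alpha \+ gram_fun beta.
Proof.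
apply/funext => x; rewrite /gram_fun /= -big_split; apply: eq_bigr => p _.
by rewrite mulmxDr mxE mulrDl.
Qed.

Lemma gram_fun_scale a alpha : gram_fun (a *: alpha) = a \*o gram_fun alpha.
Proof.
apply/funext => x; rewrite /gram_fun /= mulr_sumr; apply: eq_bigr => p _.
by rewrite -scalemxAr mxE mulrA.
Qed.

Variables (C : set (cube R d -> R)) (n : nat) (X : 'I_n -> cube R d) (y : 'I_n -> R).
Hypothesis C_convex : convex_functions C.
Hypothesis C_closed : uniformly_closed C.
Hypothesis admissible_ex : exists alpha : coefs S, admissible C X y alpha.

Lemma argmin_exists : exists alpha : coefs S, argmin (admissible C X y)
  (fun alpha : coefs S => (alpha^T *m invmx (gram k S) *m alpha) 0 0) alpha.
Proof.
pose D := [set nrm (gram_fun alpha) | alpha in admissible (S := S) C X y].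
have hi : has_inf D.
  have [alpha ha] := admissible_ex; split; first by exists (nrm (gram_fun alpha)), alpha.
  by exists 0 => _ [beta _ <-]; exact: norm_ge0.
pose dd := inf D.
have dle alpha : admissible C X y alpha -> dd <= nrm (gram_fun alpha).
  by move=> ha; apply: ge_inf; [case: hi|exists alpha].
have /choice[al hal] : forall p, exists alpha, admissible C X y alpha /\
    nrm (gram_fun alpha) < dd + p.+1%:R^-1.
  move=> p; have [|_ [alpha ha <-] ?] := @inf_adherent _ D p.+1%:R^-1 _ hi.
    by rewrite invr_gt0.
  by exists alpha.
pose u p := gram_fun (al p).
have hu p : mem (u p) by exact: gram_fun_mem.
have ud : tends_to (fun p => nrm (u p)) dd.
  move=> e e0; have [N hN] := cvg_tends_to (@cvg_harmonic R) e0.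
  exists N => p /hN /=; rewrite subr0 ger0_norm ?invr_ge0// => pe.
  have [hp1 hp2] := hal p; rewrite ger0_norm ?subr_ge0 ?dle//.
  by apply: le_trans pe; rewrite lerBlDl; exact: ltW.
have mid p q : 2 * dd <= nrm (u p \+ u q).
  have hm : admissible C X y (2^-1 *: (al p + al q)).
    have [[ip Cp] _] := hal p; have [[iq Cq] _] := hal q.
    have YE : Yfun (2^-1 *: (al p + al q)) =
        (fun x => 2^-1 * Yfun (al p) x + (1 - 2^-1) * Yfun (al q) x).
      apply/funext => x; rewrite /Yfun !mulr_sumr -big_split.
      by apply: eq_bigr => l _; rewrite !mxE /=; lra.
    rewrite /admissible /= YE; split; last by apply: C_convex => //; lra.
    by move=> i; rewrite ip iq; lra.
  have := dle _ hm; rewrite gram_fun_scale gram_fun_add norm_scale; last first.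
    by apply: mem_add; exact: gram_fun_mem.
  by rewrite ger0_norm ?invr_ge0// -/(u p) -/(u q); lra.
have [f hf uf] : exists2 f, mem f & tends_to (fun p => nrm (u p \- f)) 0.
  apply: (minimizing_cauchy hu ud) => e e0; exists 0%N => p q _ _.
  by have := mid p q; lra.
have fd : nrm f <= dd.
  apply/ler_addgt0Pr => e e0; have e20 : 0 < e / 2 by lra.
  have [N hN] := tends_to0_le uf e20; have [M hM] := ud _ e20.
  have := hN _ (leq_maxl N M); have := hM _ (leq_maxr N M); move: (maxn N M) => p.
  rewrite ler_distl => /andP[_ h1] h2.
  have := norm_dist hf (hu p); rewrite norm_subC// ler_distl => /andP[_]; lra.
exists (grid_values f).
have unif (e : R) : 0 < e -> exists N, forall p, (N <= p)%N ->
    forall x, `|Yfun (al p) x - Yfun (grid_values f) x| <= e.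
  move=> e0; pose K := \sum_p Num.sqrt (k (knotp p) (knotp p)).
  have K0 : 0 <= K by apply: sumr_ge0 => p _; exact: sqrtr_ge0.
  have e1 : 0 < e / (K + 1) by rewrite divr_gt0//; lra.
  have [N hN] := tends_to0_le uf e1; exists N => p Np x.
  rewrite Yfun_grid_values (Yfun_interpolant (gram_fun_knot (al p))) -/(u p).
  have -> : interpolant S (u p) x - interpolant S f x = interpolant S (u p \- f) x.
    by rewrite interpolant_sub.
  apply: interpolant_le => // l.
  have -> : knot l = knotp (enum_rank l) by rewrite /knotp enum_rankK.
  apply: le_trans (eval_le _ (mem_sub (hu p) hf)) _.
  apply: (@le_trans _ _ (e / (K + 1) * K)); last exact: div_succ_mul_le (ltW e0) K0.
  apply: ler_pM; rewrite ?norm_ge0 ?sqrtr_ge0//; first exact: hN.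
  by rewrite /K (bigD1 (enum_rank l))//= lerDl sumr_ge0// => q _; exact: sqrtr_ge0.
split.
  split; last first.
    by apply: (C_closed (u := fun p => Yfun (al p))) => // p; have [[]] := hal p.
  move=> i; apply/eqP; rewrite -subr_eq0 -normr_le0.
  apply/ler_addgt0Pr => e e0; rewrite add0r; have [N hN] := unif e e0.
  by have [[ip _] _] := hal N; rewrite -(ip i) distrC; exact: hN.
move=> beta hb; rewrite -!norm_gram_fun ler_pXn2r ?nnegrE ?norm_ge0//.
by apply: le_trans (dle beta hb); apply: le_trans fd; exact: gram_fun_min.
Qed.

(** The mode is the grid interpolant of an element that minimizes the norm over
   the whole RKHS. Modes of different grids thus solve problems posed in one
   and the same Hilbert space, where they can be compared. *)
Lemma mode_rkhs : exists2 h, mem h & [/\ interpolant S h = mode k S C X y,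
  C (interpolant S h), interpolating X y (interpolant S h) &
  forall f, mem f -> C (interpolant S f) -> interpolating X y (interpolant S f) ->
    nrm h <= nrm f].
Proof.
have := xgetPex 0 argmin_exists; rewrite -/(mode_coefs k S C X y).
rewrite /mode; set al := mode_coefs _ _ _ _ _ => -[[inter CC] hmin].
have E := Yfun_interpolant (gram_fun_knot al).
exists (gram_fun al); first exact: gram_fun_mem.
rewrite -E; split=> // f hf Cf If.
apply: le_trans (gram_fun_min hf).
rewrite -(@ler_pXn2r _ 2) ?nnegrE ?norm_ge0// !norm_gram_fun.
by apply: hmin; rewrite /admissible /= Yfun_grid_values.
Qed.

End finite_mode.

(** * Compactness of the cube and continuity of the kernel *)

Section cube_topology.
Context (R : realType) (d : nat).

Lemma ball_cube (x z : cube R d) (r : R) : 0 < r ->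
  (forall k, `|cube_coord x k - cube_coord z k| < r) -> ball x r z.
Proof. by move=> r0 h; split=> // i j; rewrite (ord1 i); exact: h. Qed.

Lemma ball_cube_coord (x z : cube R d) (r : R) k :
  ball x r z -> `|cube_coord x k - cube_coord z k| < r.
Proof. by move=> [_ h]; exact: h. Qed.

Lemma to_cube_val (x : cube R d) : to_cube (\val x) = x.
Proof. by apply: val_inj; rewrite /to_cube val_insubd; case: x => x /= ->. Qed.

Lemma cube_compact : compact (cube R d).
Proof.
have := @rV_compact R d (fun=> `[0, 1]%classic) (fun=> @segment_compact R 0 1).
congr compact; apply/seteqP; split=> x /= hx k; have := hx k; by rewrite /= in_itv.
Qed.

(** Compactness in the form of a Lebesgue number argument: it turns a property
   that holds eventually in i on a ball around each point into one that holds
   eventually in i on the whole cube. *)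
Lemma cube_covering (I : Type) (F : set_system I) (P : I -> cube R d -> Prop) :
  Filter F ->
  (forall x, exists2 r : R, 0 < r &
     \forall i \near F, forall x', ball x r x' -> P i x') ->
  \forall i \near F, forall x, P i x.
Proof.
move=> FF cov.
have /compact_near_coveringP/near_covering_withinP nc := cube_compact.
have : \forall i \near F, cube R d `<=` (fun x => P i (to_cube x)).
  apply: nc => x hx; have [r r0 hr] := cov (to_cube x).
  exists (ball x r, [set i | forall x', ball (to_cube x) r x' -> P i x']).
    by split=> //=; exact: nbhsx_ballx.
  move=> [x' i] /= [bx hi] hx'; apply: hi.
  by apply: ball_cube => // k; rewrite !coord_to_cube//; have [_] := bx; apply.
apply: filterS => i hi x; rewrite -(to_cube_val x); apply: hi.
by case: x => x /= hx; exact: set_mem.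
Qed.

End cube_topology.

Section kernel_continuity.
Context (R : realType) (D : nat) (kD : cube R D -> cube R D -> R).
Hypothesis kD_continuous :
  continuous (fun p : cube R D * cube R D => kD p.1 p.2 : R).

Lemma kernel_close (e : R) : 0 < e -> exists2 r : R, 0 < r & forall x z,
  (forall i, `|cube_coord x i - cube_coord z i| < r) ->
  `|kD x x + kD z z - 2 * kD x z| <= e.
Proof.
move=> e0.
have : \forall i \near (0 : R)^'+, forall x : cube R D, forall z,
    (forall j, `|cube_coord x j - cube_coord z j| < i) ->
    `|kD x x + kD z z - 2 * kD x z| <= e.
  apply: cube_covering => x.
  have e40 : 0 < e / 4 by lra.
  have /cvgrPdist_le /(_ _ e40) /nbhs_ballP[r /= r0 hr] := @kD_continuous (x, x).
  have r20 : 0 < r / 2 by lra.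
  exists (r / 2) => //; near=> i => x' xx' z x'z.
  have ir : i < r / 2 by near: i; exact: nbhs_right_lt.
  have bx : ball x r x' by apply: le_ball xx'; lra.
  have bz : ball x r z.
    apply: ball_cube => // j; have := ball_cube_coord j xx'; have := x'z j.
    have := ler_distD (cube_coord x' j) (cube_coord x j) (cube_coord z j); lra.
  have h p q : ball x r p -> ball x r q -> `|kD x x - kD p q| <= e / 4.
    by move=> hp hq; exact: (hr (p, q)).
  have := h _ _ bx bx; have := h _ _ bz bz; have := h _ _ bx bz.
  rewrite !ler_norml => /andP[? ?] /andP[? ?] /andP[? ?].
  by apply/andP; split; lra.
move=> H; have [i [i0 hi]] := filter_ex (filterI (nbhs_right_gt 0) H).
by exists i.
Unshelve. all: by end_near. Qed.

Lemma kernel_bounded : exists B : R, forall x, `|kD x x| <= B.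
Proof.
have : \forall i \near +oo, forall x : cube R D, `|kD x x| <= i.
  apply: cube_covering => x.
  have /cvgrPdist_le /(_ _ ltr01) /nbhs_ballP[r /= r0 hr] := @kD_continuous (x, x).
  exists r => //; near=> i => x' xx'.
  have : `|kD x x - kD x' x'| <= 1 by exact: (hr (x', x')).
  have : `|kD x x| + 1 <= i by near: i; exact: nbhs_pinfty_ge.
  have := ler_norm (kD x x); have := ler_norm (- kD x x); rewrite normrN.
  rewrite !ler_norml => ? ? ? /andP[? ?].
  by apply/andP; split; lra.
by move=> H; have [i hi] := filter_ex H; exists i.
Unshelve. all: by end_near. Qed.

Variable J : {set 'I_D}.

Lemma coord_zero_ext (u : cube R #|J|) i :
  cube_coord (zero_ext u) i =
  if [pick k : 'I_#|J| | enum_val k == i] is Some k then cube_coord u k else 0.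
Proof.
rewrite coord_row// => j; case: pickP => [k _|_]; first exact: coord01.
by rewrite lexx ler01.
Qed.

(** Balls of the RKHS are equicontinuous; the modulus is written as
   e + C |x - z|_1, the form that passes through interpolation. *)
Lemma kernel_modulus (H : rkhs (kernelJ kD J)) (e : R) : 0 < e ->
  exists2 C : R, 0 <= C & forall f, rkhs_space H f -> forall x z,
    `|f x - f z| <=
    rkhs_norm H f * (e + C * \sum_k `|cube_coord x k - cube_coord z k|).
Proof.
move=> e0; have [B hB] := kernel_bounded.
have B0 : 0 <= B by apply: le_trans (hB (to_cube 0)).
have e20 : 0 < e ^+ 2 by rewrite exprn_gt0.
have [r r0 hr] := kernel_close e20.
pose C := 2 * Num.sqrt B / r.
have C0 : 0 <= C by rewrite divr_ge0// ?mulr_ge0 ?sqrtr_ge0// ltW.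
exists C => // f hf x z; apply: le_trans (eval_sub_le x z hf) _.
rewrite ler_wpM2l ?norm_ge0//.
set s := \sum_k _; have s0 : 0 <= s by apply: sumr_ge0.
set q := _ - _; have [sr|rs] := ltrP s r.
  have qe : q <= e ^+ 2.
    apply: le_trans (ler_norm _) _; apply: hr => i; rewrite !coord_zero_ext.
    case: pickP => [k _|_]; last by rewrite subrr normr0.
    apply: le_lt_trans sr; rewrite /s (bigD1 k)//= lerDl; exact: sumr_ge0.
  apply: (@le_trans _ _ e); last by rewrite lerDl mulr_ge0.
  by rewrite -[e]gtr0_norm// -sqrtr_sqr ler_wsqrtr.
apply: (@le_trans _ _ (2 * Num.sqrt B)); last first.
  apply: (@le_trans _ _ (C * s)); last by rewrite lerDr ltW.
  rewrite -[leLHS](divfK (lt0r_neq0 r0)) -/C ler_wpM2l//.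
have nb v : rkhs_norm H ((kernelJ kD J)^~ v) <= Num.sqrt B.
  rewrite norm_kernel; apply: ler_wsqrtr.
  by apply: le_trans (hB (zero_ext v)); exact: ler_norm.
rewrite /q -(norm_kernel_sub H).
apply: le_trans (norm_sub (kernel_mem H x) (kernel_mem H z)) _.
have := nb x; have := nb z; lra.
Qed.

End kernel_continuity.

Section uniform_convergence.
Context (R : realType) (D : nat).

Lemma closed_uniformly_closed (C : set (cube R D -> R)) :
  closed (C : set {uniform cube R D -> R}) -> uniformly_closed C.
Proof.
move=> cC u f Cu uf; apply: cC => U /uniform_nbhs[E [entE EU]].
move: entE; rewrite -entourage_ballE => -[e /= e0 he].
have e20 : 0 < e / 2 by lra.
have [N hN] := uf _ e20; exists (u N); split; first exact: Cu.
apply: EU => x _; apply: he; rewrite /ball /= distrC.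
by apply: le_lt_trans (hN N (leqnn N) x) _; lra.
Qed.

Lemma cvg_uniform_le (u : nat -> cube R D -> R) f :
  (forall e : R, 0 < e -> exists N, forall p, (N <= p)%N ->
     forall x, `|u p x - f x| <= e) -> {uniform, u @ \oo --> f}.
Proof.
move=> uf U /uniform_nbhs[E [entE EU]].
move: entE; rewrite -entourage_ballE => -[e /= e0 he].
have e20 : 0 < e / 2 by lra.
have [N hN] := uf _ e20; exists N => // p /= Np.
apply: EU => x _; apply: he; rewrite /ball /= distrC.
by apply: le_lt_trans (hN p Np x) _; lra.
Qed.

End uniform_convergence.

(** * Convergence of the modes for a fixed set of variables *)

Section subdivision_extension.
Context (R : realType).

Definition add_points (S : {fset R}) (s : seq R) : {fset R} :=
  foldr (fun t S' => (t |` S')%fset) S s.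

Lemma add_points_subdivision S s : is_subdivision S ->
  (forall t, t \in s -> 0 <= t <= 1) -> is_subdivision (add_points S s).
Proof.
move=> hS; elim: s => [//|t s ih] hs /=; apply: subdivision_add.
  by apply: ih => r rs; apply: hs; rewrite inE rs orbT.
by apply: hs; exact: mem_head.
Qed.

Lemma mem_add_points S s t : (t \in add_points S s) = (t \in S) || (t \in s).
Proof.
elim: s => [|r s ih] /=; first by rewrite orbF.
by rewrite !inE ih orbCA.
Qed.

End subdivision_extension.

Section fixed_dimension.
Context (R : realType) (d n : nat) (k : cube R d -> cube R d -> R) (H : rkhs k).
Context (S : nat -> 'I_d -> {fset R}).
Context (C Cdot : set (cube R d -> R)) (X : 'I_n -> cube R d) (y : 'I_n -> R).
Local Notation nrm := (rkhs_norm H).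
Local Notation mem := (rkhs_space H).

Hypothesis hS : forall m j, is_subdivision (S m j).
Hypothesis nest : forall m j, (S m j `<=` S m.+1 j)%fset.
Hypothesis gram_unit : forall S' : 'I_d -> {fset R},
  (forall j, is_subdivision (S' j)) -> gram k S' \in unitmx.
Hypothesis modulus : forall e : R, 0 < e -> exists2 K : R, 0 <= K &
  forall f, mem f -> forall x z,
    `|f x - f z| <= nrm f * (e + K * \sum_j `|cube_coord x j - cube_coord z j|).
Hypothesis bounded : exists2 B : R, 0 <= B & forall f, mem f -> forall x,
  `|f x| <= B * nrm f.
Hypothesis C_convex : convex_functions C.
Hypothesis C_closed : uniformly_closed C.
Hypothesis C_interpolant : forall S' : 'I_d -> {fset R},
  (forall j, is_subdivision (S' j)) -> forall f, C f -> C (interpolant S' f).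
Hypothesis Cdot_sub : Cdot `<=` C.
Hypothesis Cdot_admissible : forall m, exists alpha : coefs (S m),
  admissible Cdot X y alpha.
Hypothesis data_onto : forall v : 'I_n -> R, exists f : cube R d -> R,
  interpolant (S 0%N) f = f /\ forall i, f (X i) = v i.
Hypothesis Cdot_interior : forall h, Cdot h ->
  forall (r : nat) (U : 'I_r -> cube R d), injective U ->
  rkhs_interior H (rkhs_space H `&` C) `&` interpolating U (fun i => h (U i)) !=set0.

Lemma nest_le p q j : (p <= q)%N -> (S p j `<=` S q j)%fset.
Proof. by move=> pq; apply: (nested_le (S := fun m => S m j)) pq. Qed.

(** The interpolation error is small, uniformly on balls of the RKHS, at all
   points close to the grid coordinate by coordinate, even though the grid
   itself may have large cells. *)
Lemma interpolant_error_unif (e : R) : 0 < e -> exists2 eta : R, 0 < eta &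
  forall S' : 'I_d -> {fset R}, (forall j, is_subdivision (S' j)) ->
  forall f x, mem f ->
    (forall j, exists s, s \in S' j /\ `|cube_coord x j - s| <= eta) ->
    `|interpolant S' f x - f x| <= e * nrm f.
Proof.
move=> e0; have e20 : 0 < e / 2 by lra.
have [K K0 hK] := modulus e20.
pose c := 2 * K * d%:R; have c0 : 0 <= c by rewrite !mulr_ge0.
exists (e / 2 / (c + 1)); first by rewrite divr_gt0//; lra.
move=> S' hS' f x hf /choice[t ht].
rewrite distrC; apply: (@le_trans _ _ (nrm f * (e / 2) + 2 * (nrm f * K) *
    \sum_j `|cube_coord x j - t j|)).
  apply: interpolant_error => //.
  - by rewrite mulr_ge0// norm_ge0.
  - by move=> j; have [] := ht j.
  - by move=> z; rewrite -[nrm f * K * _]mulrA -mulrDr; exact: hK.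
apply: (@le_trans _ _ (nrm f * (e / 2) +
    2 * (nrm f * K) * (d%:R * (e / 2 / (c + 1))))).
  rewrite lerD2l ler_wpM2l ?mulr_ge0 ?norm_ge0//.
  rewrite -[X in X%:R](card_ord d) mulr_natl -sumr_const; apply: ler_sum => j _.
  by have [] := ht j.
have := div_succ_mul_le (ltW e20) c0; have := norm_ge0 H f.
have -> : 2 * (nrm f * K) * (d%:R * (e / 2 / (c + 1))) =
  nrm f * (e / 2 / (c + 1) * c) by rewrite /c; ring.
move: (nrm f) (_ / _ * c) => a b; nra.
Qed.

(** Both interpolants agree with f on the coarse grid, so their difference is
   the fine interpolant of the coarse interpolation error. *)
Lemma interpolant_cauchy (e : R) : 0 < e -> exists M, forall m m',
  (M <= m)%N -> (m <= m')%N -> forall f, mem f -> forall x,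
  `|interpolant (S m') f x - interpolant (S m) f x| <= e * nrm f.
Proof.
move=> e0; have [eta eta0 heta] := interpolant_error_unif e0.
have [M hM] := nested_dense_family nest eta0.
exists M => m m' Mm mm' f hf x.
have -> : interpolant (S m') f x - interpolant (S m) f x =
    interpolant (S m') (f \- interpolant (S m) f) x.
  by rewrite interpolant_sub (interpolant_fine (hS m))// => j; exact: nest_le.
apply: interpolant_le => // l; rewrite /= distrC; apply: heta => // j.
have [s sS hs] := hM m m' Mm j _ (coord_knot_mem (hS m') l j) (coord01 _ j).
by exists s.
Qed.

(** The corners of the limit cells of the data points. As no knot lies inside
   these boxes, averaging an interpolant over the corners of a box gives its
   value at the data point. *)
Lemma limit_boxes : exists u v : 'I_n -> 'I_d -> R,
  [/\ forall i, in_box (u i) (v i) (X i),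
      forall i m j, gap (S m j) (u i j) (v i j) &
      forall eta : R, 0 < eta -> exists M, forall m, (M <= m)%N ->
        forall i c j, exists s, s \in S m j /\
          `|cube_coord (corner (u i) (v i) c) j - s| <= eta].
Proof.
have h (ij : 'I_n * 'I_d) := @limit_cell R (fun m => S m ij.2)
  (cube_coord (X ij.1) ij.2) (fun m => hS m ij.2) (coord01 (X ij.1) ij.2).
have [uv huv] := choice h.
exists (fun i j => (uv (i, j)).1), (fun i j => (uv (i, j)).2).
have box i : in_box (fun j => (uv (i, j)).1) (fun j => (uv (i, j)).2) (X i).
  by move=> j; have [? ? ? _ _] := huv (i, j).
split=> // [i m j|eta eta0]; first by have [_ _ _ + _] := huv (i, j); exact.
have eta20 : 0 < eta / 2 by lra.
have [M hM] := nested_dense_family nest eta20.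
exists M => m Mm i c j; have [_ _ _ _ adh] := huv (i, j).
have [|m' [s [sS s01 hs]]] := adh (cube_coord (corner (fun j => (uv (i, j)).1)
    (fun j => (uv (i, j)).2) c) j) _ _ eta20.
  by rewrite (coord_corner (box i)); case: (c j); [right|left].
have [s' s'S hs'] := hM m m' Mm j s sS s01.
exists s'; split=> //; apply: le_trans (ler_distD s _ _) _.
by rewrite (splitr eta) lerD.
Qed.

(** The stability theorem applied to the minimizers behind the modes; lam, the
   limit of the evaluations of interpolants at the data points, averages over
   the corners of the limit boxes. *)
Lemma modes_limit : exists (h : nat -> cube R d -> R) (hl : cube R d -> R)
    (lam : (cube R d -> R) -> 'I_n -> R),
  [/\ forall p, mem (h p) /\ interpolant (S p) (h p) = mode k (S p) C X y,
      mem hl /\ tends_to (fun p => nrm (h p \- hl)) 0,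
      forall e : R, 0 < e -> exists N, forall p, (N <= p)%N ->
        forall f i, mem f -> `|interpolant (S p) f (X i) - lam f i| <= e * nrm f,
      forall p, C (interpolant (S p) (h p)) /\
                interpolating X y (interpolant (S p) (h p)) &
      forall f, mem f -> (forall p, C (interpolant (S p) f)) ->
        (forall i, lam f i = y i) -> nrm hl <= nrm f].
Proof.
have [u [v [box gaps near]]] := limit_boxes.
pose lam f i := box_avg (u i) (v i) (X i) f.
have lamE m f i : lam (interpolant (S m) f) i = interpolant (S m) f (X i).
  by apply: interpolant_box.
have lam_eq f g : (forall i c, f (corner (u i) (v i) c) = g (corner (u i) (v i) c)) ->
    lam f = lam g.
  by move=> fg; apply/funext => i; apply: eq_bigr => c _; rewrite fg.
pose pts := undup [seq corner (u p.1) (v p.1) p.2 |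
  p : ('I_n * {ffun 'I_d -> bool})%type].
have ptsP i c : corner (u i) (v i) c \in pts.
  by rewrite mem_undup; apply/mapP; exists (i, c) => //; rewrite mem_enum.
(* The corners are finitely many points, so some interior point of the
   constraints agrees there with an admissible spline. *)
have [g [[hg [rho rho0 g_int]] lam_g]] : exists g, rkhs_interior H (mem `&` C) g /\
    lam g = y.
  have [alpha [inter Ch0]] := Cdot_admissible 0.
  pose U (q : 'I_(size pts)) := nth (to_cube 0) pts q.
  have U_inj : injective U.
    move=> q q' /eqP; rewrite nth_uniq ?undup_uniq// => /eqP h; exact/val_inj.
  have [g [gi gU]] := Cdot_interior Ch0 U_inj.
  exists g; split=> //; apply/funext => i; rewrite -(inter i).
  have Y0 : Yfun alpha = interpolant (S 0%N) (Yfun alpha).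
    have E := Yfun_interpolant (gram_fun_knot (gram_unit (hS 0)) alpha).
    by rewrite E interpolant_fine.
  rewrite Y0 -lamE; congr (_ i); apply: lam_eq => j c; rewrite -Y0.
  have /(nthP (to_cube 0))[q qs <-] := ptsP j c.
  by have := gU (Ordinal qs).
(* An element of the RKHS that agrees with a spline at the corners has the
   same limit evaluations, and splines take arbitrary values at the data. *)
have /choice[w hw] : forall j, exists w, mem w /\ forall i, lam w i = (j == i)%:R.
  move=> j; have [f [f0 fX]] := data_onto (fun i => (j == i)%:R).
  pose S' l := add_points (S 0%N l) [seq cube_coord x l | x <- pts].
  have hS' l : is_subdivision (S' l).
    by apply: add_points_subdivision => // t /mapP[x _ ->]; exact: coord01.
  exists (gram_fun k (grid_values S' f)); split; first exact: gram_fun_mem.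
  move=> i; rewrite -fX -f0 -lamE f0; congr (_ i); apply: lam_eq => i' c.
  have [|l <-] := @knot_of_mem _ _ _ hS' (corner (u i') (v i') c).
    move=> l; rewrite mem_add_points; apply/orP; right.
    by apply: (map_f (fun x => cube_coord x l)); exact: ptsP.
  have := gram_fun_knot (gram_unit hS') (grid_values S' f) (enum_rank l).
  by rewrite mxE /knotp enum_rankK.
have adm p : exists alpha : coefs (S p), admissible C X y alpha.
  by have [alpha [ia Ca]] := Cdot_admissible p; exists alpha; split=> //; exact: Cdot_sub.
have /choice[h hh] : forall p, exists h, mem h /\ [/\ interpolant (S p) h = mode k (S p) C X y,
    C (interpolant (S p) h), interpolating X y (interpolant (S p) h) &
    forall f, mem f -> C (interpolant (S p) f) ->
      interpolating X y (interpolant (S p) f) -> nrm h <= nrm f].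
  move=> p; have [h h1 h2] := mode_rkhs H (hS p) (gram_unit (hS p)) C_convex C_closed (adm p).
  by exists h.
have ev_close (e : R) : 0 < e -> exists N, forall p, (N <= p)%N ->
    forall f i, mem f -> `|interpolant (S p) f (X i) - lam f i| <= e * nrm f.
  move=> e0; have [eta eta0 heta] := interpolant_error_unif e0.
  have [M hM] := near _ eta0; exists M => m Mm f i hf.
  rewrite -lamE /lam box_avg_sub; apply: (box_avg_le (box i)) => b.
  by apply: heta => // j; exact: hM.
have [hl hhl [cvl minl]] : exists2 hl, mem hl &
    tends_to (fun p => nrm (h p \- hl)) 0 /\
    forall f, mem f -> (forall p, C (interpolant (S p) f)) ->
      (forall i, lam f i = y i) -> nrm hl <= nrm f.
  apply: (@minimizers_cvg _ _ _ H _ (fun p => [set f | C (interpolant (S p) f)])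
    (fun p f i => interpolant (S p) f (X i)) lam y g rho w h
    _ _ _ _ ev_close hg rho0).
  - move=> p q pq f /= Cf; rewrite -(interpolant_coarse (hS p) (hS q)).
      exact: C_interpolant.
    by move=> j; exact: nest_le.
  - move=> p f1 f2 t /= C1 C2 t01; have := C_convex C1 C2 t01; congr C.
    apply/funext => x; rewrite /interpolant !mulr_sumr -big_split.
    by apply: eq_bigr => l _ /=; ring.
  - by move=> p f1 f2 i; rewrite interpolant_add.
  - by move=> p a f i; rewrite interpolant_scale.
  - move=> p f hf fg /=; apply: C_interpolant => //.
    by have [] := g_int f hf fg.
  - by move=> i; rewrite lam_g.
  - by move=> j; have [] := hw j.
  - by move=> j i; have [_] := hw j.
  - by move=> p; have [] := hh p.
  - by move=> p; have [_ []] := hh p.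
  - by move=> p i; have [_ [_ _ + _]] := hh p; apply.
  - by move=> p f hf Cf If; have [_ [_ _ _]] := hh p; apply.
exists h, hl, lam; split=> //.
- by move=> p; have [? []] := hh p.
- by move=> p; have [_ []] := hh p.
Qed.

Lemma interpolant_norm_cvg (h : nat -> cube R d -> R) hl (e : R) :
  (forall p, mem (h p)) -> mem hl -> tends_to (fun p => nrm (h p \- hl)) 0 ->
  0 < e -> exists N, forall p, (N <= p)%N -> forall x,
    `|interpolant (S p) (h p) x - interpolant (S p) hl x| <= e.
Proof.
move=> hh hhl cvh e0; have [B B0 hB] := bounded.
have e1 : 0 < e / (B + 1) by rewrite divr_gt0//; lra.
have [N hN] := tends_to0_le cvh e1; exists N => p Np x.
have -> : interpolant (S p) (h p) x - interpolant (S p) hl x =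
  interpolant (S p) (h p \- hl) x by rewrite interpolant_sub.
apply: interpolant_le => // l.
apply: le_trans (hB _ (mem_sub (hh p) hhl) _) _.
apply: le_trans (div_succ_mul_le (ltW e0) B0).
by rewrite mulrC ler_wpM2r//; exact: hN.
Qed.

Lemma modes_cauchy (e : R) : 0 < e -> exists N, forall p q, (N <= p)%N -> (p <= q)%N ->
  forall x, `|mode k (S q) C X y x - mode k (S p) C X y x| <= e.
Proof.
move=> e0; have [h [hl [lam [hh [hhl cvh] _ _ _]]]] := modes_limit.
have hm p := (hh p).1; have hE p := (hh p).2.
have e30 : 0 < e / 3 by lra.
have [N1 h1] := interpolant_norm_cvg hm hhl cvh e30.
have nl := norm_ge0 H hl.
have e40 : 0 < e / 3 / (nrm hl + 1) by rewrite divr_gt0//; lra.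
have [N2 h2] := interpolant_cauchy e40.
exists (maxn N1 N2) => p q; rewrite geq_max => /andP[N1p N2p] pq x.
rewrite -!hE.
have a1 := h1 p N1p x; have a2 := h1 q (leq_trans N1p pq) x.
have a3 := le_trans (h2 p q N2p pq hl hhl x) (div_succ_mul_le (ltW e30) nl).
move: a1 a2 a3; rewrite !ler_norml => /andP[? ?] /andP[? ?] /andP[? ?].
by apply/andP; split; lra.
Qed.

(** When the knots become dense, interpolation tends to the identity on the
   RKHS, so that the limit functionals are the evaluations at the data points. *)
Lemma modes_dense_limit :
  (forall e : R, 0 < e -> exists M, forall m, (M <= m)%N -> forall j t,
     0 <= t <= 1 -> exists s, s \in S m j /\ `|t - s| <= e) ->
  exists Yopt, [/\ mem Yopt, C Yopt, interpolating X y Yopt,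
    forall f, mem f -> C f -> interpolating X y f -> nrm Yopt <= nrm f &
    forall e : R, 0 < e -> exists N, forall p, (N <= p)%N -> forall x,
      `|mode k (S p) C X y x - Yopt x| <= e].
Proof.
move=> dense; have [h [hl [lam [hh [hhl cvh] lam_close hC hmin]]]] := modes_limit.
have hm p := (hh p).1; have hE p := (hh p).2.
have fine f : mem f -> forall e : R, 0 < e -> exists N, forall p, (N <= p)%N ->
    forall x, `|interpolant (S p) f x - f x| <= e.
  move=> hf e e0; have nf := norm_ge0 H f.
  have e10 : 0 < e / (nrm f + 1) by rewrite divr_gt0//; lra.
  have [eta eta0 heta] := interpolant_error_unif e10.
  have [M hM] := dense _ eta0; exists M => m Mm x.
  apply: le_trans (div_succ_mul_le (ltW e0) nf).
  by apply: heta => // j; apply: hM => //; exact: coord01.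
have cvg (e : R) : 0 < e -> exists N, forall p, (N <= p)%N -> forall x,
    `|mode k (S p) C X y x - hl x| <= e.
  move=> e0; have e20 : 0 < e / 2 by lra.
  have [N1 h1] := interpolant_norm_cvg hm hhl cvh e20.
  have [N2 h2] := fine hl hhl _ e20.
  exists (maxn N1 N2) => p; rewrite geq_max => /andP[N1p N2p] x; rewrite -hE.
  apply: le_trans (ler_distD (interpolant (S p) hl x) _ _) _.
  by rewrite (splitr e) lerD ?h1 ?h2.
have lamE f i : mem f -> lam f i = f (X i).
  move=> hf; apply/eqP; rewrite -subr_eq0 -normr_le0.
  apply/ler_addgt0Pr => e e0; rewrite add0r.
  have e20 : 0 < e / 2 by lra.
  have nf := norm_ge0 H f.
  have e30 : 0 < e / 2 / (nrm f + 1) by rewrite divr_gt0//; lra.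
  have [N1 h1] := lam_close _ e30; have [N2 h2] := fine f hf _ e20.
  have := h1 _ (leq_maxl N1 N2) f i hf; have := h2 _ (leq_maxr N1 N2) (X i).
  move: (maxn N1 N2) => p a2 a1.
  have {}a1 := le_trans a1 (div_succ_mul_le (ltW e20) nf).
  apply: le_trans (ler_distD (interpolant (S p) f (X i)) _ _) _.
  by rewrite (splitr e) lerD// distrC.
exists hl; split=> //.
- apply: (C_closed (u := fun p => mode k (S p) C X y)) => // p.
  by rewrite -hE; have [] := hC p.
- move=> i; apply/eqP; rewrite -subr_eq0 -normr_le0.
  apply/ler_addgt0Pr => e e0; rewrite add0r; have [N hN] := cvg e e0.
  by have [_ /(_ i) <-] := hC N; rewrite hE distrC; exact: hN.
- move=> f hf Cf If; apply: hmin => //.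
    by move=> p; exact: C_interpolant.
  by move=> i; rewrite lamE.
Qed.

Theorem modes_convergence :
  (forall e : R, 0 < e -> exists N, forall p q, (N <= p)%N -> (p <= q)%N ->
     forall x, `|mode k (S q) C X y x - mode k (S p) C X y x| <= e) /\
  ((forall e : R, 0 < e -> exists M, forall m, (M <= m)%N -> forall j t,
      0 <= t <= 1 -> exists s, s \in S m j /\ `|t - s| <= e) ->
   exists Yopt, [/\ mem Yopt, C Yopt, interpolating X y Yopt,
     forall f, mem f -> C f -> interpolating X y f -> nrm Yopt <= nrm f &
     forall e : R, 0 < e -> exists N, forall p, (N <= p)%N -> forall x,
       `|mode k (S p) C X y x - Yopt x| <= e]).
Proof. by split; [exact: modes_cauchy|exact: modes_dense_limit]. Qed.

End fixed_dimension.

(** * Integrals of bounded functions over the cube *)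

Section bounded_integrals.
Import HBNNSimple.
Context (R : realType).

(** The integral of a nonnegative function, measurable or not, is a supremum
   over the simple functions below it. *)
Lemma integral_le_cst dT (T : measurableType dT) (mu : probability T R)
    (f : T -> R) (c : R) : (forall x, 0 <= f x <= c) ->
  0 <= \int[mu]_x f x <= c.
Proof.
move=> hf; rewrite /Rintegral.
have I0 : (0 <= \int[mu]_x (f x)%:E)%E.
  by apply: integral_ge0 => x _; rewrite lee_fin; have /andP[] := hf x.
have Ic : (\int[mu]_x (f x)%:E <= c%:E)%E.
  rewrite ge0_integralTE; last first.
    by move=> x; rewrite lee_fin; have /andP[] := hf x.
  apply: ge_ereal_sup => _ [h /= hh <-].
  rewrite -(_ : (\int[mu]_x (h x)%:E)%E = sintegral mu h); last first.
    by rewrite integral_nnsfun// patch_setT.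
  have <- : (\int[mu]_x (cst c%:E x))%E = c%:E.
    rewrite integral_cst// -[RHS]mule1; congr (_ * _)%E; exact: probability_setT.
  apply: ge0_le_integral => //.
  - by move=> x _; rewrite lee_fin.
  - by apply/measurable_EFinP; exact: measurable_funP.
  - move=> x _; apply: le_trans (hh x) _; rewrite lee_fin.
    by have /andP[] := hf x.
move: I0 Ic; case: (integral _ _ _) => [r| |] //=.
by rewrite !lee_fin => -> ->.
Qed.

Lemma cube_integral_le (d : nat) (f : cube R d -> R) (c : R) :
  (forall x, 0 <= f x <= c) -> 0 <= cube_integral f <= c.
Proof. by move=> hf; apply: integral_le_cst => x; exact: hf. Qed.

End bounded_integrals.

(** * Change of active variables *)

Section active_variables.
Context (R : realType) (D : nat).
Implicit Types (J : {set 'I_D}) (S : 'I_D -> {fset R}).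

Lemma coord_subvec J (x : cube R D) k :
  cube_coord (subvec J x) k = cube_coord x (enum_val k).
Proof. by rewrite coord_row// => j; exact: coord01. Qed.

Lemma coord_zero_ext_in J (u : cube R #|J|) k :
  cube_coord (zero_ext u) (enum_val k) = cube_coord u k.
Proof.
rewrite coord_zero_ext; case: pickP => [l /eqP/enum_val_inj->//|/(_ k)].
by rewrite eqxx.
Qed.

Lemma subvecK (x : cube R D) : zero_ext (subvec [set: 'I_D]%SET x) = x.
Proof.
apply: cube_ext => i; have iT : i \in [set: 'I_D]%SET by rewrite inE.
by rewrite -(enum_rankK_in iT iT) coord_zero_ext_in coord_subvec.
Qed.

Lemma zero_extK J (u : cube R #|J|) : subvec J (zero_ext u) = u.
Proof. by apply: cube_ext => k; rewrite coord_subvec coord_zero_ext_in. Qed.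

Lemma subvec_zero_ext_sub J J' (x : cube R D) : J \subset J' ->
  subvec J (zero_ext (subvec J' x)) = subvec J x.
Proof.
move=> JJ'; apply: cube_ext => k; rewrite !coord_subvec.
have kJ' : enum_val k \in J' by apply: (fintype.subsetP JJ'); exact: enum_valP.
by rewrite -(enum_rankK_in kJ' kJ') coord_zero_ext_in coord_subvec.
Qed.

Lemma restr_subdivision J S : is_subdivisions J S ->
  forall k, is_subdivision (restr J S k).
Proof. by move=> hS k; apply: hS; exact: enum_valP. Qed.

(** Extends hypotheses that speak of restrictions to J to all grids of the
   corresponding dimension. *)
Lemma restr_surj J (S' : 'I_#|J| -> {fset R}) : (forall k, is_subdivision (S' k)) ->
  exists2 S, is_subdivisions J S & restr J S = S'.
Proof.
move=> hS'.
exists (fun j => if [pick k : 'I_#|J| | enum_val k == j] is Some k then S' k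
                 else subdiv0 R).
  by move=> j _; case: pickP => [k _|_]; [exact: hS'|exact: subdivision0].
apply/funext => k; rewrite /restr; case: pickP => [l /eqP/enum_val_inj->//|/(_ k)].
by rewrite eqxx.
Qed.

(** Averages of tensor products over a box factor into one-dimensional ones. *)
Lemma interpolant_prod d (S' : 'I_d -> {fset R}) (g : 'I_d -> R -> R) :
  (forall k, is_subdivision (S' k)) ->
  (forall k u v x, gap (S' k) u v -> u <= x <= v ->
     g k x = (1 - ratio u v x) * g k u + ratio u v x * g k v) ->
  interpolant S' (fun x => \prod_k g k (cube_coord x k)) =
  (fun x => \prod_k g k (cube_coord x k)).
Proof.
move=> hS' hg; apply/funext => x.
have [u [v [hx gaps hu hv]]] := cell_box hS' x.
rewrite -(interpolant_box hS' _ hx gaps).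
transitivity (\sum_c box_weight u v x c *
    \prod_k g k (cube_coord (corner u v c) k)).
  apply: eq_bigr => c _; congr (_ * _); apply: interpolant_mem => // k.
  by rewrite (coord_corner hx); case: (c k).
rewrite (box_avg_prod hx); apply: eq_bigr => k _; rewrite -hg//.
by have [] := hx k.
Qed.

Lemma interpolant_sum d (S' : 'I_d -> {fset R}) (I : finType) (c : I -> R)
    (F : I -> cube R d -> R) :
  interpolant S' (fun x => \sum_i c i * F i x) =
  (fun x => \sum_i c i * interpolant S' (F i) x).
Proof.
apply/funext => x; rewrite /interpolant.
under eq_bigr do rewrite mulr_suml.
rewrite exchange_big; apply: eq_bigr => i _ /=.
by rewrite mulr_sumr; apply: eq_bigr => l _; rewrite mulrA.
Qed.

(** The lifted basis functions are tensor products with the factor 1 in each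
   added variable, hence affine in each variable between consecutive knots of
   the finer grid. *)
Lemma Yfun_lift J J' S S' (alpha : coefs (restr J S)) : J \subset J' ->
  is_subdivisions J S -> is_subdivisions J' S' ->
  (forall j, j \in J -> (S j `<=` S' j)%fset) ->
  interpolant (restr J' S') (fun x => Yfun alpha (subvec J (zero_ext x))) =
  (fun x => Yfun alpha (subvec J (zero_ext x))).
Proof.
move=> JJ' hS hS' SS'; rewrite interpolant_sum; apply/funext => x.
apply: eq_bigr => l _; congr (_ * _).
pose lv a := if [pick k : 'I_#|J| | enum_val k == a] is Some k then l k : nat else 0%N.
have lvE k : lv (enum_val k) = l k.
  rewrite /lv; case: pickP => [k' /eqP/enum_val_inj->//|/(_ k)].
  by rewrite eqxx.
pose phi a t := if a \in J then
  hat (node (S a) (lv a)) (node (S a) (lv a).+1) (node (S a) (lv a).+2) t else 1.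
have E : (fun z : cube R #|J'| => basis_fun l (subvec J (zero_ext z))) =
    (fun z => \prod_k phi (enum_val k) (cube_coord z k)).
  apply/funext => z.
  transitivity (\prod_(a in J) phi a (cube_coord (zero_ext z) a)).
    rewrite big_enum_val /=; apply: eq_bigr => k _.
    by rewrite /phi enum_valP lvE coord_subvec.
  transitivity (\prod_(a in J') phi a (cube_coord (zero_ext z) a)).
    rewrite [RHS](big_setID J) /= (finset.setIidPr JJ') [X in _ = _ * X]big1 ?mulr1//.
    by move=> a; rewrite inE /phi => /andP[/negPf ->].
  by rewrite big_enum_val /=; apply: eq_bigr => k _; rewrite coord_zero_ext_in.
rewrite -[RHS]/((fun z : cube R #|J'| => basis_fun l (subvec J (zero_ext z))) x).
rewrite E (@interpolant_prod _ (restr J' S') (fun k => phi (enum_val k))) //.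
  exact: restr_subdivision.
move=> k u v t guv utv; rewrite /phi; case: ifPn => [aJ|_]; last by rewrite !mulr1 subrK.
apply: hat_affine => //; first exact: hS.
  rewrite -(enum_rankK_in aJ aJ) lvE.
  exact: ltn_ord.
by move=> s sS; apply: guv; apply: (fsubsetP (SS' _ aJ)).
Qed.

Lemma constraint_closed (CD : set (cube R D -> R)) J :
  uniformly_closed CD -> uniformly_closed (constraintJ CD J).
Proof.
move=> cC u f Cu uf; apply: (cC (fun p x => u p (subvec J x))) => //.
by move=> e e0; have [N hN] := uf e e0; exists N => p Np x; exact: hN.
Qed.

Lemma constraint_convex (CD : set (cube R D -> R)) J :
  convex_functions CD -> convex_functions (constraintJ CD J).
Proof.
move=> cC f g t Cf Cg t01.
exact: (cC (fun x => f (subvec J x)) (fun x => g (subvec J x))).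
Qed.

End active_variables.

(** * The MaxMod algorithm *)

Section distance.
Context (R : realType).
Implicit Types (S : {fset R}) (t : R).

Lemma dist_lbound S t : has_lbound [set `|t - u| | u in [set` S]].
Proof. by exists 0 => _ [u _ <-]. Qed.

Lemma dist_le S t s : s \in S -> dist t [set` S] <= `|t - s|.
Proof. by move=> sS; apply: ge_inf; [exact: dist_lbound|exists s]. Qed.

Lemma dist_ge0 S t s : s \in S -> 0 <= dist t [set` S].
Proof.
move=> sS; apply: lb_le_inf; first by exists `|t - s|, s.
by move=> _ [u _ <-].
Qed.

Lemma dist_lt S t s0 (e : R) : s0 \in S -> dist t [set` S] < e ->
  exists2 s, s \in S & `|t - s| < e.
Proof.
move=> s0S de; have hi : has_inf [set `|t - u| | u in [set` S]].
  by split; [exists `|t - s0|, s0|exact: dist_lbound].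
have gap0 : 0 < e - dist t [set` S] by rewrite subr_gt0.
have [_ [s sS <-] hs] := inf_adherent gap0 hi.
by exists s => //; apply: lt_le_trans hs _; rewrite addrC; exact/le_of_eq/subrK.
Qed.

End distance.

Lemma card_stationary (T : finType) (J : nat -> {set T}) :
  (forall m, J m \subset J m.+1) -> exists m0, forall m, (m0 <= m)%N -> J m = J m0.
Proof.
move=> sub.
have mono p q : (p <= q)%N -> J p \subset J q.
  move=> /subnK <-; elim: (q - p)%N => [|j ih]; first exact: fintype.subxx.
  by rewrite addSn; exact: fintype.subset_trans ih (sub _).
have ex : exists c, `[< exists m, #|J m| = c >].
  by exists #|J 0%N|; apply/asboolP; exists 0%N.
have bd c : `[< exists m, #|J m| = c >] -> (c <= #|T|)%N.
  by move=> /asboolP[m <-]; exact: max_card.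
case: (ex_maxnP ex bd) => c /asboolP[m0 hm0] hmax.
exists m0 => m mm; apply/esym/eqP; rewrite eqEcard mono//= hm0.
by apply: hmax; apply/asboolP; exists m.
Qed.

Section maxmod.
Context (R : realType) (D n : nat) (kD : cube R D -> cube R D -> R).
Hypothesis kD_continuous :
  continuous (fun p : cube R D * cube R D => kD p.1 p.2 : R).
Hypothesis gram_invertible : forall (J : {set 'I_D}) (S : 'I_D -> {fset R}),
  (0 < #|J|)%N -> is_subdivisions J S ->
  gram (kernelJ kD J) (restr J S) \in unitmx.
Context (HD : rkhs kD) (HJ : forall J : {set 'I_D}, rkhs (kernelJ kD J)).
Context (CD : set (cube R D -> R)).
Context (Cdot : forall J : {set 'I_D}, set (cube R #|J| -> R)).
Arguments Cdot : clear implicits.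
Hypothesis Cdot_sub : forall J : {set 'I_D}, (0 < #|J|)%N ->
  Cdot J `<=` constraintJ CD J.
Context (X : 'I_n -> cube R D) (y : 'I_n -> R).
Context (Delta Delta' : R).
Hypothesis Delta_gt0 : 0 < Delta.
Hypothesis Delta'_gt0 : 0 < Delta'.
Context (a b : nat -> R) (J : nat -> {set 'I_D}) (S : nat -> 'I_D -> {fset R}).
Hypothesis b_gt0 : forall m, 0 < b m.
Hypothesis J0_neq0 : (0 < #|J 0%N|)%N.
Hypothesis S0_subdivision : is_subdivisions (J 0%N) (S 0%N).
Hypothesis b_small : forall m,
  2 * b m * ((\max_(i in J 0%N) #|` S 0%N i|) + m)%N%:R < 1.
Hypothesis run : maxmod_run kD CD X y Delta Delta' a b J S.
Hypothesis a_cvg0 : a @ \oo --> (0 : R).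
Hypothesis CD_convex : convex_functions CD.
Hypothesis CD_closed : uniformly_closed CD.
Hypothesis Cdot_admissible : forall (J' : {set 'I_D}) (S' : 'I_D -> {fset R}),
  J 0%N \subset J' -> is_subdivisions J' S' ->
  (forall j, j \in J 0%N -> (S 0%N j `<=` S' j)%fset) ->
  exists alpha, @admissible R _ (restr J' S') (Cdot J') n (XJ X J') y alpha.
Hypothesis data_onto : forall v : 'I_n -> R,
  exists alpha : coefs (restr (J 0%N) (S 0%N)),
    forall i, Yfun alpha (XJ X (J 0%N) i) = v i.
Hypothesis Cdot_interior : forall J' : {set 'I_D}, (0 < #|J'|)%N ->
  forall h, Cdot J' h ->
  forall (r : nat) (U : 'I_r -> cube R #|J'|), injective U ->
  rkhs_interior (HJ J') (rkhs_space (HJ J') `&` constraintJ CD J')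
    `&` interpolating U (fun i => h (U i)) !=set0.
Hypothesis CD_interpolant : forall (J' : {set 'I_D}) (S' : 'I_D -> {fset R}),
  (0 < #|J'|)%N -> is_subdivisions J' S' ->
  forall f, constraintJ CD J' f ->
  constraintJ CD J' (interpolant (restr J' S') f).

Lemma run_step m : is_subdivisions (J m) (S m) ->
  [/\ J m \subset J m.+1, is_subdivisions (J m.+1) (S m.+1) &
      forall j, j \in J m -> (S m j `<=` S m.+1 j)%fset].
Proof.
move=> hS; have [i [t [[[t01 _] _]]]] := run m.
rewrite /maxmod_step; case: ifPn => iJ [-> ->].
  split=> // j jJ; rewrite /add_knot; case: ifP => _.
  - by apply: subdivision_add => //; exact: hS.
  - exact: hS.
  - exact: fsubsetUr.
  - exact: fsubset_refl.
split; first exact: subsetU1.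
  move=> j; rewrite !inE /add_variable => /orP[/eqP ->|jJ].
    by rewrite eqxx; exact: subdivision0.
  by case: eqP => _; [exact: subdivision0|exact: hS].
move=> j jJ; rewrite /add_variable; case: eqP => [ji|//].
by rewrite ji (negPf iJ) in jJ.
Qed.

Lemma run_subdivision m : is_subdivisions (J m) (S m).
Proof. by elim: m => [//|m /run_step[]]. Qed.

Lemma run_active m : J 0%N \subset J m.
Proof.
elim: m => [|m ih]; first exact: fintype.subxx.
by have [h _ _] := run_step (@run_subdivision m); exact: fintype.subset_trans ih h.
Qed.

Lemma run_initial m j : j \in J 0%N -> (S 0%N j `<=` S m j)%fset.
Proof.
move=> jJ; elim: m => [|m ih]; first exact: fsubset_refl.
have [_ _ h] := run_step (@run_subdivision m); apply: fsubset_trans ih _.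
by apply: h; exact: (fintype.subsetP (run_active m)).
Qed.

Section stationary.
Variables (m0 : nat) (Jc : {set 'I_D}).
Hypothesis hJ : forall m, (m0 <= m)%N -> J m = Jc.

Lemma Jc_gt0 : (0 < #|Jc|)%N.
Proof.
by rewrite -(hJ (leqnn m0)); apply: leq_trans J0_neq0 (subset_leq_card (run_active m0)).
Qed.

Lemma Jc_subdivision p : is_subdivisions Jc (S (m0 + p)%N).
Proof. by rewrite -(hJ (leq_addr p m0)); exact: run_subdivision. Qed.

Lemma Jc_nest p j : j \in Jc -> (S (m0 + p)%N j `<=` S (m0 + p.+1)%N j)%fset.
Proof.
move=> jJ; have [_ _ h] := run_step (@run_subdivision (m0 + p)%N).
by rewrite addnS; apply: h; rewrite hJ// leq_addr.
Qed.

Lemma stationary_modes :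
  (forall e : R, 0 < e -> exists N, forall p q, (N <= p)%N -> (p <= q)%N ->
     forall x, `|modeJ kD CD X y Jc (S q) x - modeJ kD CD X y Jc (S p) x| <= e) /\
  ((forall e : R, 0 < e -> exists M, forall m, (M <= m)%N -> forall j t,
      j \in Jc -> 0 <= t <= 1 -> exists s, s \in S m j /\ `|t - s| <= e) ->
   exists Yopt, [/\ rkhs_space (HJ Jc) Yopt, constraintJ CD Jc Yopt,
     interpolating (XJ X Jc) y Yopt,
     forall f, rkhs_space (HJ Jc) f -> constraintJ CD Jc f ->
       interpolating (XJ X Jc) y f ->
       rkhs_norm (HJ Jc) Yopt <= rkhs_norm (HJ Jc) f &
     forall e : R, 0 < e -> exists N, forall p, (N <= p)%N -> forall x,
       `|modeJ kD CD X y Jc (S p) x - Yopt x| <= e]).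
Proof.
have J0c : J 0%N \subset Jc by rewrite -(hJ (leqnn m0)); exact: run_active.
have hS p : forall j, is_subdivision (restr Jc (S (m0 + p)%N) j).
  by apply: restr_subdivision; exact: Jc_subdivision.
have nest p j : (restr Jc (S (m0 + p)%N) j `<=` restr Jc (S (m0 + p.+1)%N) j)%fset.
  by apply: Jc_nest; exact: enum_valP.
have gram_unit (S' : 'I_#|Jc| -> {fset R}) : (forall j, is_subdivision (S' j)) ->
    gram (kernelJ kD Jc) S' \in unitmx.
  by move=> /restr_surj[S'' hS'' <-]; apply: gram_invertible => //; exact: Jc_gt0.
have stable (S' : 'I_#|Jc| -> {fset R}) : (forall j, is_subdivision (S' j)) ->
    forall f, constraintJ CD Jc f -> constraintJ CD Jc (interpolant S' f).
  by move=> /restr_surj[S'' hS'' <-]; apply: CD_interpolant => //; exact: Jc_gt0.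
have bounded : exists2 B : R, 0 <= B & forall f, rkhs_space (HJ Jc) f -> forall x,
    `|f x| <= B * rkhs_norm (HJ Jc) f.
  have [B hB] := kernel_bounded kD_continuous.
  exists (Num.sqrt B); first exact: sqrtr_ge0.
  move=> f hf x; apply: le_trans (eval_le x hf) _; rewrite mulrC.
  rewrite ler_wpM2r ?norm_ge0//; apply: ler_wsqrtr.
  by apply: le_trans (hB (zero_ext x)); exact: ler_norm.
have adm p : exists alpha : coefs (restr Jc (S (m0 + p)%N)),
    admissible (Cdot Jc) (XJ X Jc) y alpha.
  apply: Cdot_admissible => //; first exact: Jc_subdivision.
  by move=> j; exact: run_initial.
have onto (v : 'I_n -> R) : exists f, interpolant (restr Jc (S (m0 + 0)%N)) f = f /\
    forall i, f (XJ X Jc i) = v i.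
  have [alpha ha] := data_onto v.
  exists (fun x => Yfun alpha (subvec (J 0%N) (zero_ext x))); split.
    rewrite Yfun_lift//; first exact: Jc_subdivision.
    by move=> j; exact: run_initial.
  by move=> i; rewrite /XJ subvec_zero_ext_sub//; exact: ha.
have [cauchy dense] := modes_convergence hS nest gram_unit
  (fun e e0 => kernel_modulus kD_continuous (HJ Jc) e0) bounded
  (@constraint_convex _ _ _ Jc CD_convex) (@constraint_closed _ _ _ Jc CD_closed)
  stable (Cdot_sub Jc_gt0) adm onto (Cdot_interior Jc_gt0).
split.
  move=> e e0; have [N hN] := cauchy e e0; exists (m0 + N)%N => p q pN pq x.
  have pm : (m0 <= p)%N by apply: leq_trans pN; exact: leq_addr.
  have qm : (m0 <= q)%N by exact: leq_trans pq.
  have := hN (p - m0)%N (q - m0)%N _ _ x; rewrite /modeJ !subnKC//; apply.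
    by rewrite leq_subRL.
  exact: leq_sub2r.
move=> hd; have [|Y [Y1 Y2 Y3 Y4 Y5]] := dense.
  move=> e e0; have [M hM] := hd e e0; exists M => m Mm j t t01.
  by apply: hM => //; [exact: leq_trans (leq_addl _ _)|exact: enum_valP].
exists Y; split=> // e e0; have [N hN] := Y5 e e0; exists (m0 + N)%N => p pN x.
have pm : (m0 <= p)%N by apply: leq_trans pN; exact: leq_addr.
have := hN (p - m0)%N _ x; rewrite /modeJ subnKC//; apply.
by rewrite leq_subRL.
Qed.

Lemma crit_ge0 (J' : {set 'I_D}) S' i t : 0 <= crit kD CD X y J' S' i t.
Proof.
rewrite /crit mulr_ge0 ?invr_ge0//; case: ifP => _.
  by apply: fine_ge0; apply: integral_ge0 => x _; rewrite lee_fin sqr_ge0.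
by apply: fine_ge0; apply: integral_ge0 => x _; rewrite lee_fin sqr_ge0.
Qed.

Lemma crit_le (J' : {set 'I_D}) S' i t (e : R) : i \in J' -> 0 <= e <= 1 ->
  (forall x, `|modeJ kD CD X y J' (add_knot S' i t) x - modeJ kD CD X y J' S' x| <= e) ->
  crit kD CD X y J' S' i t <= e.
Proof.
move=> iJ /andP[e0 e1] he; rewrite /crit iJ.
set f := (X in cube_integral X).
have /andP[I0 Ie] : 0 <= cube_integral f <= e.
  apply: cube_integral_le => x; rewrite /f sqr_ge0/=.
  apply: (@le_trans _ _ (e ^+ 2)); last by rewrite expr2 ler_piMr.
  by rewrite -real_normK ?num_real// ler_pXn2r ?nnegrE.
apply: le_trans Ie; rewrite ler_piMl//.
case: (crit_norm _ _ _) => [|N]; first by rewrite invr0.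
by rewrite invf_le1// ler1n.
Qed.

(** The selected candidate adds a knot that is close to the existing ones and
   barely changes the mode; being almost optimal, it bounds every reward. *)
Lemma reward_small (e : R) : 0 < e -> exists N, forall m, (N <= m)%N ->
  forall i t, candidate (b m) Jc (S m) i t ->
    reward Delta Delta' Jc (S m) i t <= e.
Proof.
move=> e0; have e40 : 0 < e / 4 by lra.
pose e1 := Num.min 1 (e / 4); have e10 : 0 < e1 by rewrite lt_min ltr01.
have e1e : e1 <= e / 4 by rewrite ge_min lexx orbT.
have e11 : 0 <= e1 <= 1 by rewrite (ltW e10) ge_min lexx.
have [N1 h1] := stationary_modes.1 e1 e10.
have eta0 : 0 < e / 4 / Delta by rewrite divr_gt0.
have [N2 h2] := @nested_dense_family R #|Jc| (fun p => restr Jc (S (m0 + p)%N)) _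
  (fun p k => Jc_nest p (enum_valP k)) eta0.
have [N3 h3] := tends_to0_le (cvg_tends_to a_cvg0) e40.
exists (maxn (m0 + N2) (maxn N1 N3)) => m; rewrite !geq_max => /andP[N2m /andP[N1m N3m]].
have mm : (m0 <= m)%N by apply: leq_trans N2m; exact: leq_addr.
have [i [t [[[t01 _] sup] step]]] := run m.
rewrite /maxmod_step (hJ mm) (hJ (leqW mm)) in step sup.
have iJ : i \in Jc.
  apply: contraT => iJ; move: step; rewrite (negPf iJ) => -[Ji _].
  by rewrite Ji !inE eqxx in iJ.
move: step; rewrite iJ => -[_ Sm].
have crit_small : crit kD CD X y Jc (S m) i t <= e / 4.
  apply: le_trans e1e; apply: crit_le => // x; rewrite -Sm.
  by apply: h1 => //; exact: leqnSn.
have reward_le : reward Delta Delta' Jc (S m) i t <= e / 4.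
  rewrite /reward iJ mulrC -ler_pdivlMr//.
  have tS : t \in S (m0 + (m - m0).+1)%N i.
    by rewrite addnS subnKC// Sm /add_knot eqxx !inE eqxx.
  have := h2 (m - m0)%N (m - m0).+1 _ (enum_rank_in iJ i) t.
  rewrite /restr enum_rankK_in// subnKC// => /(_ _ tS t01)[|s sS hs].
    by rewrite leq_subRL.
  exact: le_trans (dist_le t sS) hs.
have am := h3 m N3m.
move=> i' t' cand.
have : ((crit kD CD X y Jc (S m) i' t' + reward Delta Delta' Jc (S m) i' t')%:E <=
    (crit kD CD X y Jc (S m) i t + reward Delta Delta' Jc (S m) i t + a m)%:E)%E.
  by apply: le_trans sup; apply: ereal_sup_ubound; exists (i', t').
rewrite lee_fin; have := crit_ge0 Jc (S m) i' t'; move: crit_small reward_le am.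
move: (crit _ _ _ _ _ _ i t) (crit _ _ _ _ _ _ i' t') (reward _ _ _ _ i t).
move: (reward _ _ _ _ i' t') (a m) => r' am' c c' r; lra.
Qed.

(** A variable that is never activated would keep the reward Delta'. *)
Lemma all_active : Jc = [set: 'I_D]%SET.
Proof.
apply/setP => i; rewrite inE; apply: contraT => iJ.
have D20 : 0 < Delta' / 2 by rewrite divr_gt0.
have [N hN] := reward_small D20.
have := hN N (leqnn N) i 0; rewrite /reward (negPf iJ) => H.
have : Delta' <= Delta' / 2; last lra.
by apply: H; split; [rewrite lexx ler01|rewrite (negPf iJ)].
Qed.

Lemma b_le (e : R) : 0 < e -> exists N, forall m, (N <= m)%N -> b m <= e.
Proof.
move=> e0; have [N hN] := tends_to0_le (cvg_tends_to (@cvg_harmonic R)) e0.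
exists N.+1 => -[//|m] Nm; apply: le_trans (hN m Nm).
rewrite /harmonic /= -[leRHS]mul1r ler_pdivlMr//.
have := b_small m.+1; have := b_gt0 m.+1; rewrite natrD.
have : 0 <= (\max_(i in J 0%N) #|` S 0%N i|)%:R :> R by [].
have : 0 <= m.+1%:R :> R by [].
move: (_%:R) (_%:R) (b _) => x z c; nra.
Qed.

(** A point that stays away from the knots would keep a reward bounded below. *)
Lemma knots_dense (e : R) : 0 < e -> exists N, forall m, (N <= m)%N ->
  forall j t, 0 <= t <= 1 -> dist t [set` S m j] <= e.
Proof.
move=> e0; have De : 0 < Delta * e by rewrite mulr_gt0.
have [N1 h1] := reward_small De; have [N2 h2] := b_le e0.
exists (maxn N1 N2) => m; rewrite geq_max => /andP[N1m N2m] j t t01.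
have jJ : j \in Jc by rewrite all_active inE.
have [bd|db] := lerP (b m) (dist t [set` S m j]); last first.
  by apply: le_trans (ltW db) _; exact: h2.
have := h1 m N1m j t; rewrite /reward jJ ler_pM2l//; apply.
by split.
Qed.

Lemma modes_limit_all : exists Yopt, [/\ rkhs_space (HJ Jc) Yopt,
  constraintJ CD Jc Yopt, interpolating (XJ X Jc) y Yopt,
  forall f, rkhs_space (HJ Jc) f -> constraintJ CD Jc f ->
    interpolating (XJ X Jc) y f ->
    rkhs_norm (HJ Jc) Yopt <= rkhs_norm (HJ Jc) f &
  forall e : R, 0 < e -> exists N, forall p, (N <= p)%N -> forall x,
    `|modeJ kD CD X y Jc (S p) x - Yopt x| <= e].
Proof.
apply: stationary_modes.2 => e e0; have e20 : 0 < e / 2 by lra.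
have [N hN] := knots_dense e20.
exists (maxn m0 N) => m; rewrite geq_max => /andP[mm Nm] j t jJ t01.
have /is_subdivisionP[_ S0 _ _ _] : is_subdivision (S m j).
  by apply: run_subdivision; rewrite hJ.
have [|s sS hs] := @dist_lt _ _ t _ e S0.
  by apply: le_lt_trans (hN m Nm j t t01) _; lra.
by exists s; split=> //; exact: ltW.
Qed.

End stationary.

(** With all variables active, the RKHS over the cube of the active variables
   and the one over the full cube are isometric through the change of index. *)
Lemma transport_argmin (Y : cube R #|[set: 'I_D]%SET| -> R) :
  rkhs_space (HJ [set: 'I_D]%SET) Y -> constraintJ CD [set: 'I_D]%SET Y ->
  interpolating (XJ X [set: 'I_D]%SET) y Y ->
  (forall f, rkhs_space (HJ [set: 'I_D]%SET) f -> constraintJ CD [set: 'I_D]%SET f ->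
    interpolating (XJ X [set: 'I_D]%SET) y f ->
    rkhs_norm (HJ [set: 'I_D]%SET) Y <= rkhs_norm (HJ [set: 'I_D]%SET) f) ->
  argmin (rkhs_space HD `&` CD `&` interpolating X y) (rkhs_norm HD) =
  [set fun x => Y (subvec [set: 'I_D]%SET x)].
Proof.
set Jt := [set: 'I_D]%SET => hY CY IY minY.
have kE x z : kD x z = kernelJ kD Jt (subvec Jt x) (subvec Jt z).
  by rewrite /kernelJ !subvecK.
have [hYs nYs] := rkhs_pullback HD (@zero_extK R D Jt) kE hY.
have min f : rkhs_space HD f -> CD f -> interpolating X y f ->
    rkhs_norm (HJ Jt) Y <= rkhs_norm HD f.
  move=> hf Cf If.
  have [hfz <-] := rkhs_pullback (HJ Jt) (@subvecK R D) (fun u v => erefl) hf.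
  apply: minY => //; last by move=> i; rewrite /XJ /= subvecK; exact: If.
  by rewrite /constraintJ /=; have -> : (fun x => f (zero_ext (subvec Jt x))) = f
    by apply/funext => x; rewrite subvecK.
have IYs : interpolating X y (Y \o subvec Jt) by exact: IY.
apply/seteqP; split; last first.
  move=> _ ->; split; first by split.
  by move=> z [[hz Cz] Iz]; rewrite [leLHS]nYs; exact: min.
move=> f [[[hf Cf] If] minf] /=.
have fY : rkhs_norm HD f = rkhs_norm HD (Y \o subvec Jt).
  apply/eqP; rewrite eq_le minf /=; last by split.
  by rewrite nYs; exact: min.
have half : 0 <= (2^-1 : R) <= 1 by lra.
have hs := mem_add hf hYs; have hmid := mem_scale 2^-1 hs.
have mid : rkhs_norm HD f <= rkhs_norm HD (2^-1 \*o (f \+ (Y \o subvec Jt))).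
  apply: minf; split; first split=> //.
    have := CD_convex Cf (CY : CD (Y \o subvec Jt)) half.
    by congr CD; apply/funext => x /=; lra.
  by move=> i /=; have /= -> := IYs i; rewrite If; lra.
rewrite norm_scale// ger0_norm ?invr_ge0// in mid.
have := parallelogram hf hYs; rewrite -fY.
have f0 := norm_ge0 HD f; set s := rkhs_norm HD (f \+ _) in mid *.
have s2 : (2 * rkhs_norm HD f) ^+ 2 <= s ^+ 2.
  by rewrite ler_pXn2r ?nnegrE ?norm_ge0 ?mulr_ge0//; lra.
move=> dd; have d0 : rkhs_norm HD (f \- (Y \o subvec Jt)) ^+ 2 <= 0.
  by rewrite dd; move: s2; rewrite exprMn; lra.
have d00 : rkhs_norm HD (f \- (Y \o subvec Jt)) = 0.
  by apply/eqP; rewrite -sqrf_eq0 eq_le d0 sqr_ge0.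
have /(congr1 (fun h => h _)) E := norm_eq0 (mem_sub hf hYs) d00.
by apply/funext => x; have /eqP := E x; rewrite /= subr_eq0 => /eqP.
Qed.

Theorem maxmod_convergence :
  [/\ \forall m \near \oo, J m = [set: 'I_D]%SET,
      forall (j : 'I_D) (x : R), 0 <= x <= 1 ->
        (fun m => dist x [set` S m j]) @ \oo --> (0 : R) &
      exists Yopt : cube R D -> R,
        argmin (rkhs_space HD `&` CD `&` interpolating X y) (rkhs_norm HD) = [set Yopt] /\
        {uniform, (fun m x => modeJ kD CD X y (J m) (S m) (subvec (J m) x)) @ \oo
           --> Yopt}].
Proof.
have [m0 hm0] := card_stationary (fun m => let: And3 h _ _ := run_step (@run_subdivision m) in h).
have JT := all_active hm0.
have hJ m : (m0 <= m)%N -> J m = [set: 'I_D]%SET by move=> /hm0 ->.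
split.
- by exists m0.
- move=> j x x01; apply: tends_to_cvg => e e0.
  have [N hN] := knots_dense hJ e0; exists (maxn m0 N) => m.
  rewrite geq_max => /andP[mm Nm]; rewrite subr0 ger0_norm; first exact: hN.
  have /is_subdivisionP[_ S0 _ _ _] : is_subdivision (S m j).
    by apply: run_subdivision; rewrite hJ// inE.
  exact: dist_ge0 S0.
have [Y [Y1 Y2 Y3 Y4 Y5]] := modes_limit_all hJ.
exists (fun x => Y (subvec [set: 'I_D]%SET x)); split; first exact: transport_argmin.
apply: cvg_uniform_le => e e0; have [N hN] := Y5 e e0.
exists (maxn m0 N) => p; rewrite geq_max => /andP[mp Np] x.
by rewrite (hJ p mp); exact: hN.
Qed.

End maxmod.

Theorem theorem3 (R : realType) (D n : nat)
  (* the covariance function k_D *)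
  (dOm : measure_display) (Om : measurableType dOm) (P : probability Om R)
  (Z : cube R D -> {RV P >-> R}) (kD : cube R D -> cube R D -> R)
  (Z_gaussian : gaussian_process Z) (Z_centered : centered Z)
  (Z_continuous : forall w : Om, continuous (fun x : cube R D => Z x w : R))
  (Z_cov : has_covariance Z kD)
  (kD_continuous : continuous (fun p : cube R D * cube R D => kD p.1 p.2 : R))
  (gram_invertible : forall (J : {set 'I_D}) (S : 'I_D -> {fset R}),
     (0 < #|J|)%N -> is_subdivisions J S ->
     gram (kernelJ kD J) (restr J S) \in unitmx)
  (HD : rkhs kD) (HJ : forall J : {set 'I_D}, rkhs (kernelJ kD J))
  (* constraints and data *)
  (CD : set (cube R D -> R)) (CD_continuous : forall f, CD f -> continuous f)
  (Cdot : forall J : {set 'I_D}, set (cube R #|J| -> R))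
  (Cdot_sub : forall J : {set 'I_D}, (0 < #|J|)%N ->
     Cdot J `<=` constraintJ CD J)
  (X : 'I_n -> cube R D) (X_inj : injective X) (y : 'I_n -> R)
  (* inputs of the algorithm *)
  (Delta Delta' : R) (Delta_gt0 : 0 < Delta) (Delta'_gt0 : 0 < Delta')
  (a b : nat -> R) (a_gt0 : forall m, 0 < a m) (b_gt0 : forall m, 0 < b m)
  (J : nat -> {set 'I_D}) (S : nat -> 'I_D -> {fset R})
  (J0_neq0 : (0 < #|J 0%N|)%N)
  (S0_subdivision : is_subdivisions (J 0%N) (S 0%N))
  (b_small : forall m,
     2 * b m * ((\max_(i in J 0%N) #|` S 0%N i|) + m)%N%:R < 1)
  (XJ0_inj : injective (XJ X (J 0%N)))
  (admissible0 : exists alpha,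
     @admissible R _ (restr (J 0%N) (S 0%N)) (constraintJ CD (J 0%N)) n
       (XJ X (J 0%N)) y alpha)
  (run : maxmod_run kD CD X y Delta Delta' a b J S)
  (a_cvg0 : a @ \oo --> (0 : R))
  (cond1 : convex_functions CD /\ closed (CD : set {uniform cube R D -> R}))
  (cond2 : forall (J' : {set 'I_D}) (S' : 'I_D -> {fset R}),
     J 0%N \subset J' -> is_subdivisions J' S' ->
     (forall j, j \in J 0%N -> (S 0%N j `<=` S' j)%fset) ->
     exists alpha,
       @admissible R _ (restr J' S') (Cdot J') n (XJ X J') y alpha)
  (cond3 : forall v : 'I_n -> R, exists alpha : coefs (restr (J 0%N) (S 0%N)),
     forall i, Yfun alpha (XJ X (J 0%N) i) = v i)
  (cond4 : forall J' : {set 'I_D}, (0 < #|J'|)%N ->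
     forall h, Cdot J' h ->
     forall (r : nat) (U : 'I_r -> cube R #|J'|), injective U ->
     rkhs_interior (HJ J') (HJ J' `&` constraintJ CD J')
       `&` interpolating U (fun i => h (U i)) !=set0)
  (cond5 : forall (J' : {set 'I_D}) (S' : 'I_D -> {fset R}),
     (0 < #|J'|)%N -> is_subdivisions J' S' ->
     forall f, constraintJ CD J' f ->
     constraintJ CD J' (interpolant (restr J' S') f))
  (cond6 : forall J' : {set 'I_D}, (0 < #|J'|)%N ->
     forall F : 'I_#|J'| -> set R,
     (forall k, [/\ closed (F k), F k `<=` `[0, 1], F k 0 & F k 1]) ->
     forall f, constraintJ CD J' f -> constraintJ CD J' (multiaffine F f)) :
  [/\ \forall m \near \oo, J m = [set: 'I_D]%SET,
      forall (j : 'I_D) (x : R), 0 <= x <= 1 ->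
        (fun m => dist x [set` S m j]) @ \oo --> (0 : R) &
      exists Yopt : cube R D -> R,
        argmin (HD `&` CD `&` interpolating X y) (rkhs_norm HD) = [set Yopt] /\
        {uniform, (fun m x => modeJ kD CD X y (J m) (S m) (subvec (J m) x)) @ \oo
           --> Yopt}].
Proof.
have [CD_convex CD_closed] := cond1.
apply: (@maxmod_convergence R D n kD _ _ HD HJ CD Cdot _ X y Delta Delta' _ _ a b J S) => //.
exact: closed_uniformly_closed.
Qed.
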